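(* There is a polynomial-time algorithm that, given an instance of 3-CNF-SAT with $n$ variables and $m$ clauses, produces an instance $(G_1,G_2)$ of Common Matching Weight that is a yes-instance if and only if the formula is satisfiable, with $|V(G_1)|=O(n/\log n)$, $|V(G_2)|=O(m/\log m)$, and with the weights of all perfect matchings of $G_1$ and $G_2$ bounded by $2^{3m}$.
   Context: In a 3-CNF-SAT instance each clause is a disjunction of exactly three literals. Common Matching Weight: given two complete bipartite graphs $G_1=(V_1\cup W_1,E_1,w_1)$ and $G_2=(V_2\cup W_2,E_2,w_2)$ with $|V_1|=|W_1|$, $|V_2|=|W_2|$ and nonnegative integer edge weights, decide whether there are perfect matchings $M_1$ of $G_1$ and $M_2$ of $G_2$ with $w_1(M_1)=w_2(M_2)$ (the weight of a matching is the sum of its edge weights). *)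

(* Defs.v *)
From Stdlib Require Import Reals.
From mathcomp Require Import all_boot.

Set Implicit Arguments.
Unset Strict Implicit.
Unset Printing Implicit Defensive.

(* ring_scope owns the delimiter R. *)
Delimit Scope R_scope with coq_R.

(** * Random access machines

    The model is the RAM of Cook and Reckhow ("Time bounded random access
    machines", 1973), over the natural numbers, so that subtraction is
    truncated.  Every instruction costs one time unit.  As there is no
    multiplication, the bit length of the largest number in memory grows by at
    most one per step (beyond the lengths of the inputs and of the constants
    of the program), so that polynomial unit-cost time coincides with
    polynomial time on Turing machines. *)

Inductive instr : Type :=
| IConst of nat & nat        (* X_i <- c *)
| IAdd of nat & nat & nat    (* X_i <- X_j + X_k *)
| ISub of nat & nat & nat    (* X_i <- X_j - X_k *)
| ILoad of nat & nat         (* X_i <- X_(X_j) *)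
| IStore of nat & nat        (* X_(X_i) <- X_j *)
| IJumpPos of nat & nat      (* if X_i > 0, go to instruction number l *)
| IRead of nat               (* X_i <- next input number *)
| IPrint of nat.             (* append X_i to the output *)

Definition program := seq instr.

Record config : Type := Config {
  pc : nat;
  mem : nat -> nat;
  input : seq nat;
  output : seq nat }.

Definition upd (X : nat -> nat) (i a : nat) : nat -> nat :=
  fun j => if j == i then a else X j.

(* Reading past the end of the input yields 0. *)
Definition exec (ins : instr) (s : config) : config :=
  let: Config l X inp out := s in
  match ins with
  | IConst i c => Config l.+1 (upd X i c) inp out
  | IAdd i j k => Config l.+1 (upd X i (X j + X k)) inp out
  | ISub i j k => Config l.+1 (upd X i (X j - X k)) inp out
  | ILoad i j => Config l.+1 (upd X i (X (X j))) inp out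
  | IStore i j => Config l.+1 (upd X (X i) (X j)) inp out
  | IJumpPos i l' => Config (if 0 < X i then l' else l.+1) X inp out
  | IRead i => Config l.+1 (upd X i (head 0 inp)) (behead inp) out
  | IPrint i => Config l.+1 X inp (rcons out (X i))
  end.

(* The machine halts when the program counter leaves the program. *)
Definition halted (P : program) (s : config) : bool := size P <= pc s.

Definition step (P : program) (s : config) : config :=
  if onth P (pc s) is Some ins then exec ins s else s.

Definition start (inp : seq nat) : config := Config 0 (fun=> 0) inp [::].

Definition outputs_within
    (P : program) (inp : seq nat) (t : nat) (out : seq nat) : Prop :=
  let s := iter t (step P) (start inp) in halted P s /\ output s = out.

Definition poly_time (A B : Type) (sizeA : A -> nat)
    (encA : A -> seq nat) (encB : B -> seq nat) (f : A -> B) : Prop :=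
  exists (P : program) (c d : nat), forall a : A,
    outputs_within P (encA a) (c * (sizeA a).+1 ^ d) (encB (f a)).

(** * 3-CNF-SAT *)

(* (i, true) is the variable x_i, and (i, false) is its negation. *)
Definition literal (n : nat) : Type := ('I_n * bool)%type.

Record cnf3 : Type := Cnf3 {
  nvars : nat;
  clauses : seq (3.-tuple (literal nvars)) }.

Definition nclauses (phi : cnf3) : nat := size (clauses phi).

Definition satisfies (phi : cnf3) (a : 'I_(nvars phi) -> bool) : bool :=
  all (fun cl : 3.-tuple (literal (nvars phi)) =>
         has (fun l => a l.1 == l.2) cl) (clauses phi).

Definition satisfiable (phi : cnf3) : Prop :=
  exists a : 'I_(nvars phi) -> bool, satisfies a.

(* Every input number below is at most max (nvars phi) (nclauses phi), and an
   explicit instance lists its variables and its clauses; hence n + m is a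
   lower bound for its bit length, and is polynomially related to it. *)
Definition cnf3_size (phi : cnf3) : nat := nvars phi + nclauses phi.

Definition encode_literal (n : nat) (l : literal n) : seq nat :=
  [:: nat_of_ord l.1; nat_of_bool l.2].

Definition encode_clause (n : nat) (cl : 3.-tuple (literal n)) : seq nat :=
  flatten (map (@encode_literal n) cl).

Definition encode_cnf3 (phi : cnf3) : seq nat :=
  [:: nvars phi, nclauses phi
    & flatten (map (@encode_clause (nvars phi)) (clauses phi))].

(** * Common Matching Weight *)

(* The complete bipartite graph on two disjoint copies V and W of 'I_side;
   weight v w is the weight of the edge joining v in V to w in W. *)
Record wgraph : Type := WGraph {
  side : nat;
  weight : 'I_side -> 'I_side -> nat }.

Definition nvertices (G : wgraph) : nat := #|{: 'I_(side G) + 'I_(side G)}|.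

(* The edge (v, w) joins v in V to w in W. *)
Definition edge (G : wgraph) := ('I_(side G) * 'I_(side G))%type.

Definition perfect_matching (G : wgraph) (M : {set edge G}) : bool :=
  [forall v, #|[set e in M | e.1 == v]| == 1] &&
  [forall w, #|[set e in M | e.2 == w]| == 1].

Definition matching_weight (G : wgraph) (M : {set edge G}) : nat :=
  \sum_(e in M) weight e.1 e.2.

Definition cmw_instance : Type := (wgraph * wgraph)%type.

Definition cmw_yes (G : cmw_instance) : Prop :=
  exists (M1 : {set edge G.1}) (M2 : {set edge G.2}),
    [/\ perfect_matching M1, perfect_matching M2
      & matching_weight M1 = matching_weight M2].

Definition encode_wgraph (G : wgraph) : seq nat :=
  side G :: [seq weight v w | v <- enum 'I_(side G), w <- enum 'I_(side G)].

Definition encode_cmw (G : cmw_instance) : seq nat :=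
  encode_wgraph G.1 ++ encode_wgraph G.2.

(* Main.v *)
Require Import Defs.
From Stdlib Require Import Reals Lra FunctionalExtensionality.
From mathcomp Require Import all_boot zify.

Set Implicit Arguments.
Unset Strict Implicit.
Unset Printing Implicit Defensive.

(** Write the number of true literals in clause j as the j-th digit in base 4.
    An assignment satisfies the formula iff its digits all lie in {1, 2, 3},
    that is, iff its weight, a sum of one contribution per variable, equals
    sum_j 4^j (1 + b_j + b'_j) for some bits b_j, b'_j.  So it suffices to turn
    a sum of n terms, each choosing one of two weights by a free bit, into the
    weight of a perfect matching of a graph with O(n / log n) vertices.

    Give each vertex v of V a block of k = Theta(log n) bits, with q = 2^k a
    small power of n, and label the edge (v, w) by the value of
    ((w mod q^2 + a (w / q^2)) mod q^2) / q, where a = v mod q is the slope of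
    v; the label tells which k bits v chooses, so every perfect matching yields
    an assignment.  Conversely the sets of w with a prescribed label for a
    prescribed slope have equal sizes, are disjoint for equal slopes and behave
    as pairwise independent for distinct slopes, up to a constant.  When a
    constant proportion of the vertices v carries bits and the others are
    unconstrained, Bonferroni's inequality gives Hall's condition for every
    choice of labels. *)

(** * A structured language compiled to the RAM *)

Definition arr := (bool * bool)%type.

Inductive expr :=
| Cst of nat
| Get of arr & expr
| Plus of expr & expr
| Minus of expr & expr.

Inductive cmd :=
| Put of arr & expr & expr
| Read of nat
| Print of expr
| Seq of cmd & cmd
| For of expr & cmd.

Record store := Store {
  cell : arr -> nat -> nat;
  unread : seq nat;
  printed : seq nat }.

(* The scalar variable number i is cell i of this array. *)
Definition vars : arr := (false, false).

Definition put (s : store) (a : arr) (i x : nat) : store :=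
  Store (fun a' i' => if (a' == a) && (i' == i) then x else cell s a' i')
        (unread s) (printed s).

Fixpoint eval (e : expr) (s : store) : nat :=
  match e with
  | Cst n => n
  | Get a e => cell s a (eval e s)
  | Plus e1 e2 => eval e1 s + eval e2 s
  | Minus e1 e2 => eval e1 s - eval e2 s
  end.

Fixpoint run (c : cmd) (s : store) : store :=
  match c with
  | Put a e1 e2 => put s a (eval e1 s) (eval e2 s)
  | Read v =>
      let s' := put s vars v (head 0 (unread s)) in
      Store (cell s') (behead (unread s)) (printed s)
  | Print e => Store (cell s) (unread s) (rcons (printed s) (eval e s))
  | Seq c1 c2 => run c2 (run c1 s)
  | For e c => iter (eval e s) (run c) s
  end.

(* The temporaries of compiled code, among them the loop counters, lie outside all
   arrays, so a computed address never hits one and [run] needs no side condition. *)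
Definition tmp (d : nat) : nat := d * 8.
(** Array cells have residues 1 to 4 modulo 8 and temporaries residue 0. The stride is a power of
    two, so that [locate] can multiply by it with three doublings. *)
Definition addr (a : arr) (i : nat) : nat := i * 8 + (a.1.*2 + a.2).+1.

Lemma addr_inj a a' i i' :
  (addr a i == addr a' i') = (a == a') && (i == i').
Proof.
apply/eqP/andP => [|[/eqP-> /eqP->]//].
by case: a a' => [[] []] [[] []]; rewrite /addr /= => h; split=> //;
  (try by apply/eqP; lia); exfalso; lia.
Qed.

Lemma addr_tmp a i d : (addr a i == tmp d) = false.
Proof. by apply/eqP; case: a => [[] []]; rewrite /addr /tmp /=; lia. Qed.

Lemma tmp_addr a i d : (tmp d == addr a i) = false.
Proof. by rewrite eq_sym addr_tmp. Qed.

Lemma tmp_inj d d' : (tmp d == tmp d') = (d == d').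
Proof. by rewrite /tmp; apply/eqP/eqP; lia. Qed.

(* Leaves in temporary d the address of the cell of a indexed by temporary d. *)
Definition locate (a : arr) (d : nat) : program :=
  nseq 3 (IAdd (tmp d) (tmp d) (tmp d)) ++
  [:: IConst (tmp d.+1) (a.1.*2 + a.2).+1; IAdd (tmp d) (tmp d) (tmp d.+1)].

Fixpoint comp_expr (e : expr) (d : nat) : program :=
  match e with
  | Cst n => [:: IConst (tmp d) n]
  | Get a e => comp_expr e d ++ locate a d ++ [:: ILoad (tmp d) (tmp d)]
  | Plus e1 e2 =>
      comp_expr e1 d ++ comp_expr e2 d.+1 ++ [:: IAdd (tmp d) (tmp d) (tmp d.+1)]
  | Minus e1 e2 =>
      comp_expr e1 d ++ comp_expr e2 d.+1 ++ [:: ISub (tmp d) (tmp d) (tmp d.+1)]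
  end.

(** [d] is the first free temporary and [l] the address of the first instruction, since jumps are
    absolute. A loop keeps its counter in temporary [d] while the body works from [d.+1] on; the
    constant 1 put in [d.+1] serves both the unconditional exit jump and the decrement. *)
Fixpoint compile (c : cmd) (d l : nat) : program :=
  match c with
  | Put a e1 e2 =>
      comp_expr e1 d ++ locate a d ++ comp_expr e2 d.+1 ++
      [:: IStore (tmp d) (tmp d.+1)]
  | Read v => [:: IRead (addr vars v)]
  | Print e => comp_expr e d ++ [:: IPrint (tmp d)]
  | Seq c1 c2 => let p := compile c1 d l in p ++ compile c2 d (l + size p)
  | For e c =>
      let h := comp_expr e d in
      let l' := l + size h + 3 in
      let b := compile c d.+1 l' in
      h ++
      [:: IJumpPos (tmp d) l'; IConst (tmp d.+1) 1;
          IJumpPos (tmp d.+1) (l' + size b + 3)] ++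
      b ++
      [:: IConst (tmp d.+1) 1; ISub (tmp d) (tmp d) (tmp d.+1);
          IJumpPos (tmp d) l']
  end.

(** An upper bound on the number of executed instructions. Sizes are taken at temporary 0 because
    they do not depend on it; a loop pays 3 for its header and 3 per round for the decrement and the
    jump back. *)
Fixpoint cost (c : cmd) (s : store) : nat :=
  match c with
  | Seq c1 c2 => cost c1 s + cost c2 (run c1 s)
  | For e c => size (comp_expr e 0) + 3 +
      \sum_(i < eval e s) (cost c (iter i (run c) s) + 3)
  | _ => size (compile c 0 0)
  end.

(** * Correctness of the compiled code *)

Definition code_at (P : program) (l : nat) (p : program) : Prop :=
  exists pre post, P = pre ++ p ++ post /\ size pre = l.

Lemma code_at_cat P l p1 p2 :
  code_at P l (p1 ++ p2) -> code_at P l p1 /\ code_at P (l + size p1) p2.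
Proof.
move=> [pre [post [-> <-]]]; split.
  by exists pre, (p2 ++ post); rewrite -!catA.
by exists (pre ++ p1), post; rewrite size_cat -!catA.
Qed.

Definition reach (P : program) (T : nat) (s s' : config) : Prop :=
  exists2 t, t <= T & iter t (step P) s = s'.

Lemma reach_trans P T1 T2 s1 s2 s3 :
  reach P T1 s1 s2 -> reach P T2 s2 s3 -> reach P (T1 + T2) s1 s3.
Proof.
move=> [t1 h1 e1] [t2 h2 e2]; exists (t2 + t1); first by rewrite addnC leq_add.
by rewrite iterD e1.
Qed.

Lemma step_at P l p ins X i o :
  code_at P l (ins :: p) ->
  step P (Config l X i o) = exec ins (Config l X i o).
Proof.
move=> [pre [post [-> <-]]]; rewrite /step /= onthE map_cat /=.
by rewrite nth_cat size_map ltnn subnn.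
Qed.

Definition straight (p : program) : bool :=
  all (fun ins => if ins is IJumpPos _ _ then false else true) p.

Definition execs (p : program) (s : config) : config :=
  foldl (fun s ins => exec ins s) s p.

Lemma execs_cat p1 p2 s : execs (p1 ++ p2) s = execs p2 (execs p1 s).
Proof. exact: foldl_cat. Qed.

Lemma straight_reach P l p X i o :
  straight p -> code_at P l p ->
  reach P (size p) (Config l X i o) (execs p (Config l X i o)).
Proof.
elim: p l X i o => [|ins p IH] l X i o; first by exists 0.
move=> /= /andP[s1 sp] cp.
rewrite -add1n.
have [c1 c2] := @code_at_cat P l [:: ins] p cp.
rewrite /= addn1 in c2.
apply: (@reach_trans _ _ _ _ (exec ins (Config l X i o))).
  by exists 1 => //=; rewrite (step_at _ _ _ cp).
by case: ins s1 {cp c1} => //= *; apply: IH.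
Qed.

Lemma straight_expr e d : straight (comp_expr e d).
Proof.
elim: e d => [n|a e IH|e1 IH1 e2 IH2|e1 IH1 e2 IH2] d //=;
by rewrite /straight !all_cat -!/(straight _) ?IH ?IH1 ?IH2.
Qed.

Lemma size_expr e d d' : size (comp_expr e d) = size (comp_expr e d').
Proof.
elim: e d d' => [n|a e IH|e1 IH1 e2 IH2|e1 IH1 e2 IH2] d d' //=;
by rewrite !size_cat ?(IH d d') ?(IH1 d d') ?(IH2 d.+1 d'.+1).
Qed.

Definition sim (s : store) (X : nat -> nat) : Prop :=
  forall a i, X (addr a i) = cell s a i.

Lemma sim_tmp s X d x : sim s X -> sim s (upd X (tmp d) x).
Proof. by move=> h a i; rewrite /upd addr_tmp. Qed.

Lemma sim_put s X a i x : sim s X -> sim (put s a i x) (upd X (addr a i) x).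
Proof. by move=> h a' i'; rewrite /upd addr_inj /=; case: ifP. Qed.

(** The temporaries below [d] hold pending operands and the counters of enclosing loops, so compiled
    code must preserve them. *)
Definition same_tmps (d : nat) (X X' : nat -> nat) : Prop :=
  forall d', d' < d -> X' (tmp d') = X (tmp d').

Lemma same_tmps_trans d d1 X Y Z :
  d <= d1 -> same_tmps d X Y -> same_tmps d1 Y Z -> same_tmps d X Z.
Proof. by move=> le h1 h2 d' lt; rewrite h2 ?h1 //; apply: leq_trans le. Qed.

Lemma same_tmps_upd d d' X x : d <= d' -> same_tmps d X (upd X (tmp d') x).
Proof. by move=> le d1 lt; rewrite /upd tmp_inj; case: eqP => //; lia. Qed.

Lemma locate_ok a d s l X i o :
  sim s X -> exists X',
  [/\ execs (locate a d) (Config l X i o) =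
        Config (l + size (locate a d)) X' i o,
      sim s X', X' (tmp d) = addr a (X (tmp d)) & same_tmps d X X'].
Proof.
move=> h; rewrite /locate /execs /=; eexists; split; first by rewrite -!addSnnS addn0.
- by do !apply: sim_tmp.
- by rewrite /upd !tmp_inj !eqxx ltn_eqF ?gtn_eqF // /addr; lia.
- by move=> d' lt; rewrite /upd !tmp_inj; do !case: eqP => //; lia.
Qed.

Lemma expr_ok e : forall d s l X i o, sim s X -> exists X',
  [/\ execs (comp_expr e d) (Config l X i o) =
        Config (l + size (comp_expr e d)) X' i o,
      sim s X', X' (tmp d) = eval e s & same_tmps d X X'].
Proof.
(* Sums and differences differ only in their last instruction, so one argument serves both. *)
have binop e1 e2 (ins : nat -> instr) (op : nat -> nat -> nat) :
  (forall d l X i o, exec (ins d) (Config l X i o) =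
     Config l.+1 (upd X (tmp d) (op (X (tmp d)) (X (tmp d.+1)))) i o) ->
  (forall d s l X i o, sim s X -> exists X',
   [/\ execs (comp_expr e1 d) (Config l X i o) =
        Config (l + size (comp_expr e1 d)) X' i o,
      sim s X', X' (tmp d) = eval e1 s & same_tmps d X X']) ->
  (forall d s l X i o, sim s X -> exists X',
   [/\ execs (comp_expr e2 d) (Config l X i o) =
        Config (l + size (comp_expr e2 d)) X' i o,
      sim s X', X' (tmp d) = eval e2 s & same_tmps d X X']) ->
  forall d s l X i o, sim s X -> exists X',
   let p := comp_expr e1 d ++ comp_expr e2 d.+1 ++ [:: ins d] in
   [/\ execs p (Config l X i o) = Config (l + size p) X' i o,
      sim s X', X' (tmp d) = op (eval e1 s) (eval e2 s) & same_tmps d X X'].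
  move=> eins IH1 IH2 d s l X i o h /=.
  have [X1 [E1 h1 r1 t1]] := IH1 d s l X i o h.
  have [X2 [E2 h2 r2 t2]] := IH2 d.+1 s (l + size (comp_expr e1 d)) X1 i o h1.
  rewrite !execs_cat E1 E2 -[execs _ _]/(exec (ins d) _) eins; eexists; split.
  - by rewrite !size_cat /= !addnA addn1.
  - exact: sim_tmp.
  - by rewrite /upd eqxx r2 t2 ?r1.
  - apply: same_tmps_trans (leqnn _) (same_tmps_trans _ t1 t2) _ => //.
    exact: same_tmps_upd.
elim: e => [n|a e IH|e1 IH1 e2 IH2|e1 IH1 e2 IH2] d s l X i o h.
- exists (upd X (tmp d) n); split => //=; first by rewrite addn1.
  + exact: sim_tmp.
  + by rewrite /upd eqxx.
  + exact: same_tmps_upd.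
- have [X1 [E1 h1 r1 t1]] := IH d s l X i o h.
  have [X2 [E2 h2 r2 t2]] := locate_ok a d (l + size (comp_expr e d)) i o h1.
  rewrite -[comp_expr (Get a e) d]/(_ ++ _ ++ _) execs_cat E1 execs_cat E2.
  eexists; split.
  - by rewrite !size_cat !addnA addn1.
  - exact: sim_tmp.
  - by rewrite /upd eqxx r2 h2 r1.
  - apply: same_tmps_trans (leqnn _) (same_tmps_trans _ t1 t2) _ => //.
    exact: same_tmps_upd.
- exact: (binop e1 e2 (fun d => IAdd (tmp d) (tmp d) (tmp d.+1)) addn).
- exact: (binop e1 e2 (fun d => ISub (tmp d) (tmp d) (tmp d.+1)) subn).
Qed.

Lemma expr_reach P e d s l X i o :
  code_at P l (comp_expr e d) -> sim s X -> exists X',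
  [/\ reach P (size (comp_expr e 0)) (Config l X i o)
        (Config (l + size (comp_expr e d)) X' i o),
      sim s X', X' (tmp d) = eval e s & same_tmps d X X'].
Proof.
move=> ca h; have [X1 [E1 h1 r1 t1]] := expr_ok e d l i o h.
exists X1; split => //; rewrite -E1 (size_expr e 0 d).
exact: straight_reach (straight_expr _ _) ca.
Qed.

Lemma compile_reach P c : forall d s l X, code_at P l (compile c d l) -> sim s X ->
  exists X',
  [/\ reach P (cost c s) (Config l X (unread s) (printed s))
        (Config (l + size (compile c d l)) X' (unread (run c s)) (printed (run c s))),
      sim (run c s) X' & same_tmps d X X'].
Proof.
elim: c => [a e1 e2|v|e|c1 IH1 c2 IH2|e c IH] d s l X ca h.
- have [X1 [E1 h1 r1 t1]] := expr_ok e1 d l (unread s) (printed s) h.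
  have [X2 [E2 h2 r2 t2]] :=
    locate_ok a d (l + size (comp_expr e1 d)) (unread s) (printed s) h1.
  have [X3 [E3 h3 r3 t3]] :=
    expr_ok e2 d.+1 (l + size (comp_expr e1 d) + size (locate a d))
      (unread s) (printed s) h2.
  exists (upd X3 (addr a (eval e1 s)) (eval e2 s)); split.
  + have st : straight (compile (Put a e1 e2) d l).
      by rewrite /straight !all_cat -!/(straight _) !straight_expr.
    have := straight_reach X (unread s) (printed s) st ca.
    rewrite /compile execs_cat E1 execs_cat E2 execs_cat E3 /execs /= !size_cat /=.
    rewrite !size_cat r3 (t3 d) // r2 r1 (size_expr e1 d 0) (size_expr e2 d.+1 1).
    by rewrite !addnS !addSn !addn0 !addnA.
  + exact: sim_put.
  + move=> d' lt; rewrite /upd tmp_addr t3 ?t2 ?t1 //; exact: ltnW.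
- exists (upd X (addr vars v) (head 0 (unread s))); split.
  + by exists 1 => //=; rewrite (step_at _ _ _ ca) addn1.
  + exact: sim_put.
  + by move=> d' _; rewrite /upd tmp_addr.
- have [X1 [E1 h1 r1 t1]] := expr_ok e d l (unread s) (printed s) h.
  exists X1; split => //.
  have st : straight (compile (Print e) d l).
    by rewrite /straight !all_cat -!/(straight _) !straight_expr.
  have := straight_reach X (unread s) (printed s) st ca.
  rewrite /compile !execs_cat E1 /execs /= !size_cat /=.
  by rewrite r1 !addn1 addnS (size_expr e d 0).
- have [ca1 ca2] := code_at_cat ca.
  have [X1 [R1 h1 t1]] := IH1 d s l X ca1 h.
  have [X2 [R2 h2 t2]] := IH2 d (run c1 s) _ X1 ca2 h1.
  exists X2; split.
  + by rewrite /= size_cat addnA; exact: reach_trans R1 R2.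
  + by [].
  + exact: (same_tmps_trans (leqnn d) t1 t2).
rewrite /compile -/compile in ca *.
set hd := comp_expr e d in ca *; set l' := l + size hd + 3 in ca *.
set b := compile c d.+1 l' in ca *; set l'' := l' + size b + 3 in ca *.
set n := eval e s.
have [caE ca1] := code_at_cat ca.
have [ca2 ca3] := code_at_cat ca1.
have [ca4 ca5] := code_at_cat ca3.
rewrite -/(l') [size _]/= -/l' in ca4 ca5.
have [X1 [R1 h1 r1 t1]] := expr_reach (unread s) (printed s) caE h.
have [_ ca21] := @code_at_cat P (l + size hd) [:: _] _ ca2.
have [_ ca22] := @code_at_cat P (l + size hd + 1) [:: _] _ ca21.
have [_ ca51] := @code_at_cat P (l' + size b) [:: _] _ ca5.
have [_ ca52] := @code_at_cat P (l' + size b + 1) [:: _] _ ca51.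
(* [m.+1] is the counter at the start of a round, when [n - m.+1] rounds are over; the induction
   runs from the last round backwards. *)
have iter_ok m : m.+1 <= n -> forall X2, sim (iter (n - m.+1) (run c) s) X2 ->
  X2 (tmp d) = m.+1 -> exists X3,
  [/\ reach P (\sum_(n - m.+1 <= i < n) (cost c (iter i (run c) s) + 3))
       (Config l' X2 (unread (iter (n - m.+1) (run c) s))
                     (printed (iter (n - m.+1) (run c) s)))
       (Config l'' X3 (unread (iter n (run c) s)) (printed (iter n (run c) s))),
      sim (iter n (run c) s) X3 & same_tmps d X2 X3].
  elim: m => [|m IHm] lt X2 h2 r2;
    have [X3 [R3 h3 t3]] := IH d.+1 _ l' X2 ca4 h2;
    rewrite -iterS subnSK // in R3 h3;
    set s3 := iter _ (run c) s in R3 h3.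
    rewrite subn0 in s3 R3 h3.
    pose X4 := upd (upd X3 (tmp d.+1) 1) (tmp d) 0.
    exists X4; split; last 2 first.
    - by do !apply: sim_tmp.
    - move=> d' ld; rewrite /X4 /upd !tmp_inj !ltn_eqF //; first by apply: t3; lia.
      exact: ltnW.
    rewrite big_ltn ?big_geq; [|lia|lia].
    rewrite addn0; apply: reach_trans R3 _.
    exists 3 => //.
    rewrite !iterS -/b (step_at _ _ _ ca5) /= -addn1 (step_at _ _ _ ca51) /=.
    rewrite -addn1 (step_at _ _ _ ca52) /=.
    rewrite {1}/upd eqxx /upd !tmp_inj !eqxx ltn_eqF // t3 // r2 /=.
    by rewrite /X4 /l'' !addnS !addn0.
  have [|||X5 [R5 h5 t5]] := IHm _ (upd (upd X3 (tmp d.+1) 1) (tmp d) m.+1).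
  + exact: ltnW.
  + by do !apply: sim_tmp.
  + by rewrite /upd eqxx.
  exists X5; split => //; last first.
    move=> d' ld; rewrite t5 // /upd !tmp_inj !ltn_eqF //; first by apply: t3; lia.
    exact: ltnW.
  rewrite big_ltn; last by lia.
  apply: reach_trans; last by rewrite subnSK //; exact: R5.
  apply: reach_trans R3 _.
  exists 3 => //.
  rewrite !iterS -/b (step_at _ _ _ ca5) /= -addn1 (step_at _ _ _ ca51) /=.
  rewrite -addn1 (step_at _ _ _ ca52) /=.
  by rewrite {1}/upd eqxx /upd !tmp_inj !eqxx ltn_eqF // t3 // r2 /= !subn1.
have -> : l + size (hd ++ [:: IJumpPos (tmp d) l'; IConst (tmp d.+1) 1;
   IJumpPos (tmp d.+1) l''] ++ b ++ [:: IConst (tmp d.+1) 1;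
   ISub (tmp d) (tmp d) (tmp d.+1); IJumpPos (tmp d) l']) = l''.
  by rewrite !size_cat /= /l'' /l'; lia.
rewrite /run -/run /cost -/cost -/n.
(* A zero count falls through the first jump and leaves by the second, whose condition is the
   constant 1. *)
case: (posnP n) => [n0|n_gt0].
  exists (upd X1 (tmp d.+1) 1); rewrite n0 /=; split.
  - rewrite big_ord0 addn0; apply: reach_trans R1 _; exists 3 => //.
    rewrite !iterS (step_at _ _ _ ca2) /= r1 -/n n0 /= -[in LHS]addn1.
    rewrite (step_at _ _ _ ca21) /= -[in LHS]addn1 (step_at _ _ _ ca22) /=.
    by rewrite {1}/upd eqxx.
  - exact: sim_tmp.
  - by apply: same_tmps_trans t1 (same_tmps_upd _ _ _).
have [|||X2 [R2 h2 t2]] := iter_ok n.-1 _ X1.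
- by rewrite prednK.
- by rewrite prednK // subnn.
- by rewrite prednK.
exists X2; split => //; last exact: same_tmps_trans t1 t2.
rewrite prednK // subnn big_mkord in R2.
apply: reach_trans R2; apply: reach_trans R1 _; exists 1 => //.
by rewrite /= (step_at _ _ _ ca2) /= r1 -/n n_gt0.
Qed.

(** * Running time and program logic *)

(* No loop is entered with a count above K. *)
Fixpoint safe (K : nat) (c : cmd) (s : store) : Prop :=
  match c with
  | Seq c1 c2 => safe K c1 s /\ safe K c2 (run c1 s)
  | For e c => eval e s <= K /\
      (forall i, i < eval e s -> safe K c (iter i (run c) s))
  | _ => True
  end.

(** Each loop multiplies the cost by at most about [K], hence raises the exponent by one; [C] and
    [D] depend on the command alone. *)
Lemma cost_safe c : exists C D, forall K s, safe K c s -> cost c s <= C * K.+1 ^ D.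
Proof.
have basic c0 : (forall s, cost c0 s = size (compile c0 0 0)) ->
    exists C D, forall K s, safe K c0 s -> cost c0 s <= C * K.+1 ^ D.
  by move=> h; exists (size (compile c0 0 0)), 0 => K s _; rewrite h muln1.
elim: c => [a e1 e2|v|e|c1 [C1 [D1 h1]] c2 [C2 [D2 h2]]|e c [C [D h]]].
- exact: basic.
- exact: basic.
- exact: basic.
- exists (C1 + C2), (D1 + D2) => K s /= [s1 s2].
  rewrite mulnDl leq_add //.
    by apply: leq_trans (h1 _ _ s1) _; rewrite leq_mul // leq_pexp2l ?leq_addr.
  by apply: leq_trans (h2 _ _ s2) _; rewrite leq_mul // leq_pexp2l ?leq_addl.
- exists (size (comp_expr e 0) + 3 + (C + 3)), D.+1 => K s /= [le sf].
  have p1 : 0 < K.+1 ^ D.+1 by rewrite expn_gt0.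
  have p2 : 0 < K.+1 ^ D by rewrite expn_gt0.
  rewrite [in leqRHS]mulnDl leq_add ?leq_pmulr //.
  apply: (@leq_trans (\sum_(i < eval e s) (C + 3) * K.+1 ^ D)).
    apply: leq_sum => i _; rewrite mulnDl leq_add ?leq_pmulr //.
    exact: h (sf _ _).
  rewrite sum_nat_const card_ord mulnCA leq_mul2l expnS leq_mul2r.
  by rewrite (leq_trans le) ?orbT.
Qed.

(** A syntactic over-approximation: a store at a computed index counts as touching the whole
    array. *)
Fixpoint writes (c : cmd) (a : arr) (i : nat) : bool :=
  match c with
  | Put a' e _ => (a == a') && (if e is Cst j then i == j else true)
  | Read v => (a == vars) && (i == v)
  | Print _ => false
  | Seq c1 c2 => writes c1 a i || writes c2 a i
  | For _ c => writes c a i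
  end.

Fixpoint reads (c : cmd) : bool :=
  match c with
  | Read _ => true
  | Seq c1 c2 => reads c1 || reads c2
  | For _ c => reads c
  | _ => false
  end.

Fixpoint prints (c : cmd) : bool :=
  match c with
  | Print _ => true
  | Seq c1 c2 => prints c1 || prints c2
  | For _ c => prints c
  | _ => false
  end.

(** Proved once for all commands, this lets loop invariants mention only what the loop changes. *)
Record framed (c : cmd) (s s' : store) : Prop := Framed {
  fr_cell : forall a i, writes c a i = false -> cell s' a i = cell s a i;
  fr_unread : reads c = false -> unread s' = unread s;
  fr_printed : prints c = false -> printed s' = printed s }.

Lemma framed_iter c n s : (forall s, framed c s (run c s)) ->
  framed c s (iter n (run c) s).
Proof.
move=> h; elim: n => [|n [h1 h2 h3]] //=.
have [k1 k2 k3] := h (iter n (run c) s).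
by split=> *; rewrite ?k1 ?k2 ?k3 ?h1 ?h2 ?h3.
Qed.

Lemma framed_run c s : framed c s (run c s).
Proof.
elim: c s => [a e1 e2|v|e|c1 IH1 c2 IH2|e c IH] s.
- split=> //= a' i; case: (a' == a) => //=.
  by case: e1 => //= n ->.
- by split=> //= a i ->.
- by split.
- have [h1 h2 h3] := IH1 s; have [k1 k2 k3] := IH2 (run c1 s).
  split=> /= [a i w|w|w]; have [/negbTE w1 /negbTE w2] := norP (negbT w);
    by rewrite ?k1 ?k2 ?k3 ?h1 ?h2 ?h3.
- by have [h1 h2 h3] := framed_iter (eval e s) s IH; split.
Qed.

(** Carrying the bound on loop counts along with the postcondition yields the running time and the
    output from a single verification. *)
Definition ok (K : nat) (c : cmd) (s : store) (Q : store -> Prop) : Prop :=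
  safe K c s /\ Q (run c s).

Lemma ok_seq K c1 c2 s Q :
  ok K c1 s (fun s' => ok K c2 s' Q) -> ok K (Seq c1 c2) s Q.
Proof. by case=> [h1 [h2 h3]]. Qed.

Lemma ok_put K a e1 e2 s (Q : store -> Prop) :
  Q (put s a (eval e1 s) (eval e2 s)) -> ok K (Put a e1 e2) s Q.
Proof. by []. Qed.

Lemma ok_read K v s (Q : store -> Prop) : Q (run (Read v) s) -> ok K (Read v) s Q.
Proof. by []. Qed.

Lemma ok_print K e s (Q : store -> Prop) : Q (run (Print e) s) -> ok K (Print e) s Q.
Proof. by []. Qed.

Lemma ok_weaken K c s (Q Q' : store -> Prop) :
  ok K c s Q -> (forall s', framed c s s' -> Q s' -> Q' s') -> ok K c s Q'.
Proof. by case=> h q hQ; split=> //; apply: hQ q; apply: framed_run. Qed.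

Lemma ok_for K e c n (I : nat -> store -> Prop) s (Q : store -> Prop) :
  eval e s = n -> n <= K -> I 0 s ->
  (forall i s', i < n -> framed c s s' -> I i s' -> ok K c s' (I i.+1)) ->
  (forall s', framed c s s' -> I n s' -> Q s') ->
  ok K (For e c) s Q.
Proof.
move=> en nK I0 hI hQ.
have fr i := framed_iter i s (framed_run c).
have inv i : i <= n -> I i (iter i (run c) s).
  by elim: i => //= i IH lt; have [] := hI _ _ lt (fr i) (IH (ltnW lt)).
split; rewrite /= en; last exact: hQ (fr n) (inv n (leqnn n)).
by split=> // i lt; have [] := hI _ _ lt (fr i) (inv _ (ltnW lt)).
Qed.

(** * The gadget *)

(** Base 32 is chosen so that [width n ^ 5] is at most [32 * n] for positive [n]; then
    [period n ^ 2 * nbits n], a part of the side times [nbits n], is still linear in [n]. *)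
Definition nbits (n : nat) : nat := (trunc_log 32 n).+1.
Definition width (n : nat) : nat := 2 ^ nbits n.
Definition period (n : nat) : nat := width n * width n.
(** The least number for which [period n * nrep n] vertices with [nbits n] bits each carry more than
    [n] bits. *)
Definition nrep (n : nat) : nat := (n %/ (period n * nbits n)).+1.
(** The first summand makes progressions of this length long enough to equidistribute; the second
    keeps the bit-carrying vertices below 1/24 of the side. *)
Definition reps (n : nat) : nat := period n + 24 * nrep n.
Definition gside (n : nat) : nat := reps n * period n.

(* Divided by width n, this is the label of the edge (v, w). *)
Definition offset (n v w : nat) : nat :=
  (w + (v %% width n) * (w %/ period n)) %% period n.

(* T (j.*2 + b) is the weight of item j when its bit is b; as q = 2 ^ k, the bits of
   the label c %/ q are read off c directly. *)
Definition entry (T : nat -> nat) (k q v j c : nat) : nat :=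
  \sum_(i < j) T ((v * k + i).*2 + odd (c %/ (q * 2 ^ i))).

Definition gweight (T : nat -> nat) (n v w : nat) : nat :=
  entry T (nbits n) (width n) v (nbits n) (offset n v w).

Definition gadget (T : nat -> nat) (n : nat) : wgraph :=
  @WGraph (gside n) (fun v w => gweight T n v w).

Lemma width_gt0 n : 0 < width n. Proof. by rewrite expn_gt0. Qed.
Lemma period_gt0 n : 0 < period n. Proof. by rewrite muln_gt0 width_gt0. Qed.

(** With [entry_high]: bit [r] is clear below [q * 2 ^ r], and adding [q * 2 ^ r] sets it without
    touching lower bits. So a table of all entries can be built by doubling. *)
Lemma entry_low T k q v r c : c < q * 2 ^ r ->
  entry T k q v r.+1 c = entry T k q v r c + T (v * k + r).*2.
Proof. by move=> lt; rewrite /entry big_ord_recr /= divn_small // addn0. Qed.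

Lemma entry_high T k q v r c : 0 < q -> c < q * 2 ^ r ->
  entry T k q v r.+1 (q * 2 ^ r + c) = entry T k q v r c + T (v * k + r).*2.+1.
Proof.
move=> q0 lt; rewrite /entry big_ord_recr /=.
have L0 : 0 < q * 2 ^ r by rewrite muln_gt0 q0 expn_gt0.
rewrite divnDl // divnn L0 divn_small // addn1; congr (_ + _).
apply: eq_bigr => i _; congr (T (_ + _)).
(* As [i < r], this is an even multiple of [q * 2 ^ i], so bit [i] is unchanged. *)
have -> : q * 2 ^ r = 2 ^ (r - i) * (q * 2 ^ i).
  by rewrite mulnCA -expnD subnK // ltnW.
rewrite divnMDl ?muln_gt0 ?q0 ?expn_gt0 // oddD oddX.
by case: i => i /= /subnSK <-.
Qed.

(** * Printing the gadget *)

Definition sums : arr := (false, true).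

Local Notation var v := (Get vars (Cst v)) (only parsing).
Local Notation assign v e := (Put vars (Cst v) e) (only parsing).
Local Notation "c1 ;; c2" := (Seq c1 c2) (at level 95, right associativity).
(* The count 1 - (e1 - e2) is 1 if e1 <= e2 and 0 otherwise. *)
Local Notation IfLe e1 e2 c := (For (Minus (Cst 1) (Minus e1 e2)) c) (only parsing).
Local Notation wrap r m :=
  (IfLe (var m) (var r) (assign r (Minus (var r) (var m)))) (only parsing).

Local Notation vN := 0 (only parsing).
Local Notation vK := 1 (only parsing).
Local Notation vq := 2 (only parsing).
Local Notation vQ := 3 (only parsing).
Local Notation vP := 4 (only parsing).
Local Notation vX := 5 (only parsing).
Local Notation vS := 6 (only parsing).
Local Notation vT := 7 (only parsing).
Local Notation va := 8 (only parsing).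
Local Notation vb := 9 (only parsing).
Local Notation vL := 10 (only parsing).
Local Notation vc := 11 (only parsing).
Local Notation vj := 12 (only parsing).

(** Logarithm and quotient are found by search: powers of 32, then multiples of
    [period n * nbits n], are increased while they are at most [n]. A while loop becomes a bounded
    loop whose guarded body eventually stops firing. *)
Definition params : cmd :=
  assign vK (Cst 1);; assign vq (Cst 2);; assign vQ (Cst 4);; assign vP (Cst 32);;
  For (var vN) (IfLe (var vP) (var vN)
    (assign vK (Plus (var vK) (Cst 1));;
     assign vq (Plus (var vq) (var vq));;
     For (Cst 2) (assign vQ (Plus (var vQ) (var vQ)));;
     For (Cst 5) (assign vP (Plus (var vP) (var vP)))));;
  assign vX (var vQ);; assign vS (Cst 0);;
  For (Plus (var vN) (Cst 1)) (IfLe (var vS) (var vN)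
    (assign vX (Plus (var vX) (Cst 24));;
     For (var vK) (assign vS (Plus (var vS) (var vQ)))));;
  assign vT (Cst 0);;
  For (var vX) (assign vT (Plus (var vT) (var vQ))).

(** For a fixed vertex the weight depends only on the offset below [q * q]. Offsets below [q] have
    label 0 and start with the empty sum; each item then doubles the table. [vb] is not reset, so it
    points at the next vertex's items afterwards. *)
Definition tabulate (A : arr) : cmd :=
  assign vj (Cst 0);;
  For (var vq) (Put sums (var vj) (Cst 0);; assign vj (Plus (var vj) (Cst 1)));;
  assign vL (var vq);;
  For (var vK)
   (assign vj (Cst 0);;
    For (var vL)
     (Put sums (Plus (var vj) (var vL))
        (Plus (Get sums (var vj)) (Get A (Plus (var vb) (Cst 1))));;
      Put sums (var vj) (Plus (Get sums (var vj)) (Get A (var vb)));;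
      assign vj (Plus (var vj) (Cst 1)));;
    assign vL (Plus (var vL) (var vL));;
    assign vb (Plus (var vb) (Cst 2))).

(** [vc] follows the offset: it rotates once through a block of [period n] columns, returns to its
    start, and then moves by the slope to the start of the next block. *)
Definition print_row : cmd :=
  assign vc (Cst 0);;
  For (var vX)
   (For (var vQ)
     (Print (Get sums (var vc));; assign vc (Plus (var vc) (Cst 1));; wrap vc vQ);;
    assign vc (Plus (var vc) (var va));; wrap vc vQ).

Definition print_graph (A : arr) : cmd :=
  params;;
  Print (var vT);; assign va (Cst 0);; assign vb (Cst 0);;
  For (var vT)
   (tabulate A;; print_row;;
    assign va (Plus (var va) (Cst 1));; wrap va vq).

(* Lets a conditional update that does not fire count as an update. *)
Lemma put_same s a i : put s a i (cell s a i) = s.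
Proof.
case: s => f u p; congr Store.
apply: functional_extensionality => a'; apply: functional_extensionality => i'.
by case: andP => //= -[/eqP-> /eqP->].
Qed.

Lemma ok_ifle K e1 e2 c s Q : 0 < K ->
  (eval e1 s <= eval e2 s -> ok K c s Q) -> (eval e2 s < eval e1 s -> Q s) ->
  ok K (IfLe e1 e2 c) s Q.
Proof.
move=> K0 h1 h2; rewrite /ok /=; case: (leqP (eval e1 s) (eval e2 s)) => le.
  have -> : 1 - (eval e1 s - eval e2 s) = 1 by lia.
  by have [h3 h4] := h1 le; split=> //; split=> // -[].
have -> : 1 - (eval e1 s - eval e2 s) = 0 by lia.
by split; [split|exact: h2].
Qed.

Lemma ok_wrap K r m s (Q : store -> Prop) : 0 < K ->
  cell s vars r < (cell s vars m).*2 ->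
  Q (put s vars r (cell s vars r %% cell s vars m)) -> ok K (wrap r m) s Q.
Proof.
move=> K0 lt h; apply: ok_ifle => //= le.
  apply: ok_put => /=.
  suff -> : cell s vars r - cell s vars m = cell s vars r %% cell s vars m by [].
  by rewrite -[in RHS](subnKC le) modnDl modn_small; lia.
by rewrite modn_small // put_same in h.
Qed.

Lemma trunc_log_eq32 n k : 32 ^ k <= n -> n < 32 ^ k.+1 -> trunc_log 32 n = k.
Proof. by move=> h1 h2; apply: trunc_log_eq; rewrite ?h1. Qed.

Lemma ok_double K v m s (Q : store -> Prop) : m <= K ->
  (forall s', framed (assign v (Plus (var v) (var v))) s s' ->
     cell s' vars v = cell s vars v * 2 ^ m -> Q s') ->
  ok K (For (Cst m) (assign v (Plus (var v) (var v)))) s Q.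
Proof.
move=> mK h; apply: (@ok_for _ _ _ m (fun i s' =>
  cell s' vars v = cell s vars v * 2 ^ i)) => //=; first by rewrite muln1.
move=> i s' _ _ e; apply: ok_put => /=; rewrite eqxx e expnS; lia.
Qed.

Lemma ok_mul K e v w m s (Q : store -> Prop) : m <= K -> eval e s = m -> v != w ->
  (forall s', framed (assign v (Plus (var v) (var w))) s s' ->
     cell s' vars v = cell s vars v + m * cell s vars w -> Q s') ->
  ok K (For e (assign v (Plus (var v) (var w)))) s Q.
Proof.
move=> mK em vw h; apply: (@ok_for _ _ _ m (fun i s' =>
  cell s' vars v = cell s vars v + i * cell s vars w)) => //=; first by rewrite addn0.
move=> i s' _ fr e1; apply: ok_put => /=; rewrite eqxx e1.
rewrite (fr_cell fr) /= ?mulSn; first lia.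
by rewrite eq_sym (negbTE vw).
Qed.

Lemma ok_params K s n : 
  cell s vars vN = n -> 5 <= K -> n < K -> nbits n <= K -> reps n <= K ->
  ok K params s (fun s' =>
    [/\ cell s' vars vK = nbits n, cell s' vars vq = width n,
        cell s' vars vQ = period n, cell s' vars vX = reps n
      & cell s' vars vT = gside n]).
Proof.
move=> hn K5 nK kK rK; rewrite /params.
do 4! [apply: ok_seq; apply: ok_put => /=].
apply: ok_seq.
(* The last disjunction says that the guard has failed or has fired in every round so far. After [n]
   rounds either one gives [n < 32 ^ k.+1]; the case [k = 0] covers small [n]. *)
apply: (@ok_for _ _ _ n (fun i s' => exists k,
  [/\ cell s' vars vK = k.+1, cell s' vars vq = 2 ^ k.+1,
      cell s' vars vQ = 2 ^ k.+1 * 2 ^ k.+1, cell s' vars vP = 32 ^ k.+1 &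
      (k = 0 \/ 32 ^ k <= n) /\ (n < 32 ^ k.+1 \/ i <= k)])) => //=.
- exact: ltnW.
- by exists 0; split=> //; split; [left|right].
- move=> i s1 lt fr [k [e1 e2 e3 e4 [hk1 hk2]]].
  have eN : cell s1 vars vN = n by rewrite (fr_cell fr) //.
  apply: ok_ifle; first by lia.
    rewrite /= e4 eN => le.
    do 2! [apply: ok_seq; apply: ok_put => /=].
    apply: ok_seq; apply: ok_double => [|s2 fr2 /= eQ]; first by lia.
    apply: ok_double => [|s3 fr3 /= eP]; first by lia.
    exists k.+1; rewrite eP.
    rewrite (fr_cell fr3 (a := vars) (i := vK)) //.
    rewrite (fr_cell fr2 (a := vars) (i := vK)) //=.
    rewrite (fr_cell fr3 (a := vars) (i := vq)) //.
    rewrite (fr_cell fr2 (a := vars) (i := vq)) //=.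
    rewrite (fr_cell fr3 (a := vars) (i := vQ)) // eQ.
    rewrite (fr_cell fr2 (a := vars) (i := vP)) //=.
    rewrite e1 e2 e3 e4; split.
    + by rewrite addn1.
    + by rewrite [2 ^ k.+2]expnS; lia.
    + by rewrite [2 ^ k.+2]expnS; lia.
    + by rewrite [32 ^ k.+2]expnS; lia.
    + by split; [right|right; lia].
  rewrite /= e4 eN => gt; exists k; split=> //; split=> //; left; exact: gt.
move=> s1 fr1 [k [e1 e2 e3 e4 [hk1 hk2]]].
have eN1 : cell s1 vars vN = n by rewrite (fr_cell fr1).
have {hk2} lt_k : n < 32 ^ k.+1.
  case: hk2 => // le; apply: (@leq_ltn_trans k) => //.
  by apply: ltn_trans (ltn_expl _ _); lia.
have ek : nbits n = k.+1.
  rewrite /nbits; congr _.+1; case: hk1 lt_k => [->|h1] h2; last exact: trunc_log_eq32.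
  by case: (posnP n) => [->//|n0]; apply: trunc_log_eq32.
have {}e1 : cell s1 vars vK = nbits n by rewrite ek.
have {}e2 : cell s1 vars vq = width n by rewrite /width ek.
have {}e3 : cell s1 vars vQ = period n by rewrite /period /width ek.
do 2! [apply: ok_seq; apply: ok_put => /=].
apply: ok_seq.
(* The same scheme for the quotient: the increment is positive, so [n.+1] rounds suffice to exceed
   [n]. *)
apply: (@ok_for _ _ _ n.+1 (fun i s' => exists j,
  [/\ cell s' vars vX = period n + 24 * j,
      cell s' vars vS = j * (period n * nbits n),
      j = 0 \/ j.-1 * (period n * nbits n) <= n
    & n < j * (period n * nbits n) \/ i <= j])) => //=.
- by rewrite eN1 addn1.
- by exists 0; rewrite e3 !addn0; split=> //; [left|right].
- move=> i s2 lt fr [j [f1 f2 hj1 hj2]].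
  have eN2 : cell s2 vars vN = n by rewrite (fr_cell fr).
  have eK2 : cell s2 vars vK = nbits n by rewrite (fr_cell fr).
  have eQ2 : cell s2 vars vQ = period n by rewrite (fr_cell fr).
  apply: ok_ifle; first by lia.
    rewrite /= f2 eN2 => le.
    apply: ok_seq; apply: ok_put => /=.
    apply: (@ok_mul _ _ _ _ (nbits n)) => // s3 fr3 /= eS.
    exists j.+1; rewrite eS f2 eQ2 (fr_cell fr3) //= f1; split.
    + lia.
    + by rewrite mulSn addnC mulnC.
    + by right.
    + by right; lia.
  by rewrite /= f2 eN2 => gt; exists j; split=> //; left.
move=> s2 fr2 [j [f1 f2 hj1 hj2]].
have eK2 : cell s2 vars vK = nbits n by rewrite (fr_cell fr2).
have eQ2 : cell s2 vars vQ = period n by rewrite (fr_cell fr2).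
have eq2 : cell s2 vars vq = width n by rewrite (fr_cell fr2).
have M0 : 0 < period n * nbits n by rewrite muln_gt0 period_gt0.
have {hj2} gt_j : n < j * (period n * nbits n).
  by case: hj2 => // le; apply: (leq_trans le); rewrite leq_pmulr.
have ej : nrep n = j.
  case: j {f1 f2} hj1 gt_j => [|j] //= [//|h1] h2; congr _.+1.
  apply/eqP; rewrite eqn_leq leq_divRL // h1 andbT -ltnS ltn_divLR //.
apply: ok_seq; apply: ok_put => /=.
apply: (@ok_mul _ _ _ _ (reps n)) => //=; first by rewrite f1 -ej.
move=> s3 fr3 /= eT; rewrite eT.
by rewrite !(fr_cell fr3) //= eK2 eq2 eQ2 f1 -ej add0n.
Qed.

Lemma ok_tabulate K x s T k v :
  let q := 2 ^ k in
  cell s vars vK = k -> cell s vars vq = q -> cell s vars vb = (v * k).*2 ->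
  (forall i, cell s (true, x) i = T i) -> k <= K -> q * q <= K ->
  ok K (tabulate (true, x)) s (fun s' =>
    cell s' vars vb = (v.+1 * k).*2 /\
    forall c, c < q * q -> cell s' sums c = entry T k q v k c).
Proof.
move=> q ek eq eb eT kK qK; rewrite /tabulate.
have q0 : 0 < q by rewrite expn_gt0.
apply: ok_seq; apply: ok_put => /=.
apply: ok_seq.
apply: (@ok_for _ _ _ q (fun i s' => cell s' vars vj = i /\
  forall c, c < i -> cell s' sums c = 0)) => //=; first by nia.
  move=> i s1 _ fr [ej h]; apply: ok_seq; do 2! [apply: ok_put => /=].
  rewrite ej addn1; split=> // c; rewrite ltnS leq_eqVlt.
  by case: eqP => //= _; apply: h.
move=> s1 fr1 [_ h1].
apply: ok_seq; apply: ok_put => /=.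
apply: (@ok_for _ _ _ k (fun r s' =>
  [/\ cell s' vars vL = q * 2 ^ r, cell s' vars vb = (v * k + r).*2 &
   forall c, c < q * 2 ^ r -> cell s' sums c = entry T k q v r c])) => //=.
- by rewrite (fr_cell fr1).
- rewrite muln1 addn0 !(fr_cell fr1) //=; split=> // c lt.
  by rewrite h1 // /entry big_ord0.
- move=> r s2 lt fr2 [eL eb2 h2].
  have L_le : q * 2 ^ r <= K.
    by apply: leq_trans qK; rewrite leq_mul2l leq_pexp2l ?orbT // ltnW.
  apply: ok_seq; apply: ok_put => /=.
  apply: ok_seq; set L := q * 2 ^ r in eL L_le h2 *.
  (* The doubling is done in place: before [l] both halves are final, and from [l] on the lower half
     still holds the previous round. The upper cell is written before the lower one is
     overwritten. *)
  apply: (@ok_for _ _ _ L (fun l s' =>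
    [/\ cell s' vars vj = l,
        forall c, c < l -> cell s' sums c = entry T k q v r.+1 c /\
                           cell s' sums (L + c) = entry T k q v r.+1 (L + c)
      & forall c, l <= c -> c < L -> cell s' sums c = entry T k q v r c])) => //=.
  + by split=> // c _; apply: h2.
  + move=> l s3 ltl fr3 [ej h3 h4].
    have eL3 : cell s3 vars vL = L by rewrite (fr_cell fr3).
    have eb3 : cell s3 vars vb = (v * k + r).*2 by rewrite (fr_cell fr3).
    have eT3 i : cell s3 (true, x) i = T i.
      by rewrite (fr_cell fr3) //= (fr_cell fr2) //= (fr_cell fr1) //= eT.
    apply: ok_seq; apply: ok_put => /=.
    apply: ok_seq; apply: ok_put => /=.
    apply: ok_put => /=.
    rewrite ej eL3 eb3 !eT3 addn1; split=> // [c lc|c lc1 lc2].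
      have lcL : c < L by lia.
      rewrite (_ : (c == l + L) = false); last by apply/eqP; lia.
      rewrite (_ : (l == l + L) = false); last by apply/eqP; lia.
      rewrite (_ : (L + c == l) = false); last by apply/eqP; lia.
      rewrite (_ : (L + c == l + L) = (c == l)); last by rewrite addnC eqn_add2r.
      move: lc; rewrite ltnS leq_eqVlt; case: (eqVneq c l) => [-> _|_ /= lc].
        have hi : entry T k q v r.+1 (L + l) = _ := entry_high T k v q0 ltl.
        by rewrite entry_low // hi h4 // addn1.
      by have [-> ->] := h3 c lc.
    rewrite (_ : (c == l) = false); last by apply/eqP; lia.
    rewrite (_ : (c == l + L) = false); last by apply/eqP; lia.
    by rewrite h4 // ltnW.
  + move=> s3 fr3 [_ h3 _].
    apply: ok_seq; do 2! [apply: ok_put => /=].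
    have eL3 : cell s3 vars vL = L by rewrite (fr_cell fr3).
    have eb3 : cell s3 vars vb = (v * k + r).*2 by rewrite (fr_cell fr3).
    have L2 : L + L = q * 2 ^ r.+1 by rewrite expnS mulnCA mul2n addnn.
    rewrite eL3 eb3 -L2 [v * k + r.+1]addnS doubleS addn2; split=> // c lc.
    case: (ltnP c L) => cL; first by have [] := h3 _ cL.
    by rewrite -(subnKC cL); have [|_ ->] := h3 (c - L); first lia.
- by move=> s2 fr2 [_ -> h2]; rewrite mulSn addnC; split.
Qed.

Lemma ok_print_row K s T n v :
  cell s vars vX = reps n -> cell s vars vQ = period n ->
  cell s vars va = v %% width n ->
  (forall c, c < period n ->
     cell s sums c = entry T (nbits n) (width n) v (nbits n) c) ->
  reps n <= K ->
  ok K print_row s (fun s' =>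
    printed s' = printed s ++ mkseq (gweight T n v) (gside n)).
Proof.
move=> eX eQ ea eR XK; rewrite /print_row.
have Q0 := period_gt0 n.
have QK : period n <= K by apply: leq_trans XK; apply: leq_addr.
have K0 : 0 < K by apply: leq_trans QK.
have a_lt : v %% width n < period n.
  by apply: (leq_trans (ltn_pmod _ (width_gt0 n))); rewrite leq_pmulr ?width_gt0.
apply: ok_seq; apply: ok_put => /=.
apply: (@ok_for _ _ _ (reps n) (fun x s' =>
  cell s' vars vc = ((v %% width n) * x) %% period n /\
  printed s' = printed s ++ mkseq (gweight T n v) (x * period n))) => //=.
- by rewrite muln0 mod0n cats0.
- move=> x s1 ltx fr1 [ec ep].
  have eQ1 : cell s1 vars vQ = period n by rewrite (fr_cell fr1).
  apply: ok_seq.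
  apply: (@ok_for _ _ _ (period n) (fun y s' =>
    cell s' vars vc = (y + (v %% width n) * x) %% period n /\
    printed s' = printed s ++ mkseq (gweight T n v) (x * period n + y))) => //=.
  + by rewrite addn0.
  + move=> y s2 lty fr2 [ec2 ep2].
    have eQ2 : cell s2 vars vQ = period n by rewrite (fr_cell fr2).
    apply: ok_seq; apply: ok_print => /=.
    apply: ok_seq; apply: ok_put => /=.
    apply: ok_wrap => //=.
      by rewrite eQ2 ec2; have := ltn_pmod (y + (v %% width n) * x) Q0; lia.
    rewrite eQ2 ec2 addn1 -[in X in X %% _ = _]addn1 modnDml addn1 addSn.
    split=> //.
    rewrite ep2 addnS mkseqS -cats1 -[in RHS]cats1 catA; congr (_ ++ [:: _]).
    rewrite (fr_cell fr2) //= (fr_cell fr1) //= eR ?ltn_pmod //.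
    rewrite /gweight /offset divnMDl // divn_small // addn0.
    by rewrite -addnA modnMDl.
  + move=> s2 fr2 [ec2 ep2].
    have eQ2 : cell s2 vars vQ = period n by rewrite (fr_cell fr2).
    have ea2 : cell s2 vars va = v %% width n.
      by rewrite (fr_cell fr2) //= (fr_cell fr1) //= ?eT.
    apply: ok_seq; apply: ok_put => /=.
    apply: ok_wrap => //=.
      by rewrite eQ2 ec2 ea2 modnDl; have := ltn_pmod ((v %% width n) * x) Q0; lia.
    rewrite eQ2 ec2 ea2 modnDl modnDml mulnS addnC; split=> //.
    by rewrite ep2 mulSn addnC.
- by move=> s1 _ [].
Qed.

Lemma encode_gadget T n :
  encode_wgraph (gadget T n) =
  gside n :: flatten (mkseq (fun v => mkseq (gweight T n v) (gside n)) (gside n)).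
Proof.
rewrite /encode_wgraph /=; congr (_ :: flatten _).
rewrite /mkseq -val_enum_ord -map_comp; apply: eq_map => v /=.
by rewrite -map_comp; apply: eq_map.
Qed.

Lemma ok_print_graph K x s T n :
  cell s vars vN = n -> (forall i, cell s (true, x) i = T i) ->
  5 <= K -> n < K -> nbits n <= K -> gside n <= K ->
  ok K (print_graph (true, x)) s (fun s' =>
    printed s' = printed s ++ encode_wgraph (gadget T n)).
Proof.
move=> en eT K5 nK kK tK.
have Q0 := period_gt0 n.
have rK : reps n <= K by apply: leq_trans tK; rewrite leq_pmulr.
have QK : period n <= K by apply: leq_trans rK; apply: leq_addr.
have a_lt : forall v, v %% width n < width n by move=> v; rewrite ltn_pmod ?width_gt0.
apply: ok_seq; apply: ok_weaken (ok_params en K5 nK kK rK) _.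
move=> s1 fr1 [eK eq eQ eX et].
apply: ok_seq; apply: ok_print.
do 2! [apply: ok_seq; apply: ok_put => /=].
apply: (@ok_for _ _ _ (gside n) (fun v s' =>
  [/\ cell s' vars va = v %% width n, cell s' vars vb = (v * nbits n).*2
    & printed s' = printed s ++ gside n ::
        flatten (mkseq (fun v => mkseq (gweight T n v) (gside n)) v)])) => //=.
- by split; rewrite ?mod0n // (fr_printed fr1) // et cats1.
- move=> v s2 ltv fr2 [ea eb ep].
  have eK2 : cell s2 vars vK = nbits n by rewrite (fr_cell fr2).
  have eq2 : cell s2 vars vq = width n by rewrite (fr_cell fr2).
  have eQ2 : cell s2 vars vQ = period n by rewrite (fr_cell fr2).
  have eX2 : cell s2 vars vX = reps n by rewrite (fr_cell fr2).
  have eT2 i : cell s2 (true, x) i = T i.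
    by rewrite (fr_cell fr2) //= (fr_cell fr1) //= ?eT.
  apply: ok_seq; apply: ok_weaken (ok_tabulate eK2 eq2 eb eT2 kK QK) _.
  move=> s3 fr3 [eb3 eR3].
  have eX3 : cell s3 vars vX = reps n by rewrite (fr_cell fr3).
  have eQ3 : cell s3 vars vQ = period n by rewrite (fr_cell fr3).
  have ea3 : cell s3 vars va = v %% width n by rewrite (fr_cell fr3).
  apply: ok_seq; apply: ok_weaken (ok_print_row eX3 eQ3 ea3 eR3 rK) _.
  move=> s4 fr4 ep4.
  have eq4 : cell s4 vars vq = width n.
    by rewrite (fr_cell fr4) //= (fr_cell fr3).
  have ea4 : cell s4 vars va = v %% width n by rewrite (fr_cell fr4).
  apply: ok_seq; apply: ok_put => /=.
  apply: ok_wrap => /=; [lia|by rewrite eq4 ea4; have := a_lt v; lia|].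
  rewrite eq4 ea4 modnDml addn1; split=> //.
    by rewrite (fr_cell fr4).
  rewrite ep4 (fr_printed fr3) // ep -catA cat_cons; congr (_ ++ _ :: _).
  by rewrite -flatten_rcons -(mkseqS (fun v => mkseq (gweight T n v) (gside n))).
- by move=> s2 _ [_ _ ->]; rewrite encode_gadget.
Qed.

(** * The reduction as a program *)

Definition lits : arr := (true, false).
Definition slack : arr := (true, true).

Local Notation vM := 13 (only parsing).
Local Notation vW := 14 (only parsing).
Local Notation vU := 15 (only parsing).
Local Notation vI := 16 (only parsing).
Local Notation vB := 17 (only parsing).

Definition read_clause : cmd :=
  For (Cst 3) (Read vI;; Read vB;;
    Put lits (Plus (Plus (var vI) (var vI)) (var vB))
      (Plus (Get lits (Plus (Plus (var vI) (var vI)) (var vB))) (var vW))).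

Definition read_clauses : cmd :=
  assign vW (Cst 1);; assign vU (Cst 0);;
  For (var vM)
   (read_clause;;
    Put slack (var vU) (var vW);;
    Put slack (Plus (var vU) (Cst 1)) (Plus (var vW) (var vW));;
    Put slack (Plus (var vU) (Cst 3)) (var vW);;
    For (Cst 2) (assign vW (Plus (var vW) (var vW)));;
    assign vU (Plus (var vU) (Cst 4))).

Definition reduction : cmd :=
  Read vN;; Read vM;; read_clauses;;
  print_graph lits;; assign vN (Plus (var vM) (var vM));; print_graph slack.

(** The code of a literal is the position where the gadget looks up that bit for that variable, so
    choosing bits means choosing the true literals. *)
Definition lit_code (n : nat) (l : literal n) : nat := l.1.*2 + l.2.

Definition codes (phi : cnf3) : seq (seq nat) :=
  [seq map (@lit_code _) (tval cl) | cl <- clauses phi].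

Definition litwt (cs : seq (seq nat)) (m x : nat) : nat :=
  \sum_(j < m) 4 ^ j * count_mem x (nth [::] cs j).

(* Items 2 * j and 2 * j + 1 together contribute 4 ^ j * (1 + b + b'). *)
Definition slackwt (m x : nat) : nat :=
  if x %/ 4 < m then 4 ^ (x %/ 4) * nth 0 [:: 1; 2; 0; 1] (x %% 4) else 0.

Definition cmw_of (phi : cnf3) : cmw_instance :=
  (gadget (litwt (codes phi) (nclauses phi)) (nvars phi),
   gadget (slackwt (nclauses phi)) (nclauses phi).*2).

Lemma drop_nth_map (S T : Type) (f : S -> T) y s i : i < size s ->
  exists x, drop i s = x :: drop i.+1 s /\ nth y (map f s) i = f x.
Proof.
elim: s i => [|x s IH] [|i] //= lt; last exact: IH.
by exists x; split=> //; rewrite drop0.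
Qed.

Lemma ok_read_clause K s n (cl : 3.-tuple (literal n)) rest :
  2 < K -> unread s = encode_clause cl ++ rest ->
  ok K read_clause s (fun s' => unread s' = rest /\
    forall x, cell s' lits x =
      cell s lits x + cell s vars vW * count_mem x (map (@lit_code _) cl)).
Proof.
move=> K2 eu.
apply: (@ok_for _ _ _ 3 (fun r s' =>
  unread s' = flatten (map (@encode_literal n) (drop r cl)) ++ rest /\
  forall x, cell s' lits x = cell s lits x +
    cell s vars vW * count_mem x (take r (map (@lit_code _) cl)))) => //=.
- by rewrite drop0 take0 -eu; split=> // x; rewrite muln0 addn0.
- move=> r s1 ltr fr [e1 e2].
  have r_lt : r < size cl by rewrite size_tuple.
  have [l [dl nl]] := drop_nth_map (@lit_code n) 0 r_lt.
  rewrite dl /= in e1.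
  apply: ok_seq; apply: ok_read; rewrite /= e1 /=.
  apply: ok_seq; apply: ok_read => /=.
  apply: ok_put => /=; split=> // x.
  rewrite (take_nth 0) ?size_map // nl -cats1 count_cat /= addn0 mulnDr addnA.
  rewrite !e2 addnn -/(lit_code l) (fr_cell fr) //= [x == _]eq_sym.
  by case: eqP => [<-|_]; rewrite ?muln1 ?muln0 ?addn0.
- by move=> s1 _; rewrite drop_oversize ?take_oversize ?size_map ?size_tuple.
Qed.

(** The tests follow the order in which later stores of a round shadow earlier ones; cell
    [m * 4 + 2] is never stored and keeps its initial 0. *)
Lemma slackwtS m x : slackwt m.+1 x =
  if x == m * 4 + 3 then 4 ^ m else if x == m * 4 + 1 then 4 ^ m + 4 ^ m
  else if x == m * 4 then 4 ^ m else slackwt m x.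
Proof.
rewrite /slackwt ltnS.
have ex := divn_eq x 4; have := ltn_pmod x (isT : 0 < 4).
set d := x %/ 4 in ex *; set r := x %% 4 in ex *; rewrite ex.
case: (ltngtP d m) => [dm|dm|->].
- by case: r ex => [|[|[|[|]]]] //= ex _; do 3! [case: eqP => ?; first by lia].
- by case: r ex => [|[|[|[|]]]] //= ex _; do 3! [case: eqP => ?; first by lia].
case: r ex => [|[|[|[|]]]] //= ex _; rewrite ?muln1 ?muln0 ?muln2 ?addnn //;
  by do 3! [case: eqP => ? //; try lia].
Qed.

Lemma ok_read_clauses K s phi :
  2 < K -> nclauses phi <= K -> cell s vars vM = nclauses phi ->
  (forall b x, cell s (true, b) x = 0) ->
  unread s = flatten (map (@encode_clause (nvars phi)) (clauses phi)) ->
  ok K read_clauses s (fun s' =>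
    (forall x, cell s' lits x = litwt (codes phi) (nclauses phi) x) /\
    (forall x, cell s' slack x = slackwt (nclauses phi) x)).
Proof.
move=> K2 mK em e0 eu.
do 2! [apply: ok_seq; apply: ok_put => /=].
apply: (@ok_for _ _ _ (nclauses phi) (fun i s' =>
  [/\ cell s' vars vW = 4 ^ i, cell s' vars vU = i * 4,
      unread s' = flatten (map (@encode_clause _) (drop i (clauses phi))) &
  (forall x, cell s' lits x = litwt (codes phi) i x) /\
  (forall x, cell s' slack x = slackwt i x)])) => //=.
- by rewrite drop0; split=> //; split=> x; rewrite e0 // /litwt big_ord0.
- move=> i s1 lti fr1 [eW eU e1 [eL eS]].
  have [cl [dc nc]] := drop_nth_map (fun cl => map (@lit_code _) (tval cl)) [::] lti.
  rewrite dc /= in e1.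
  apply: ok_seq; apply: ok_weaken (ok_read_clause K2 e1) _ => s2 fr2 [e2 eL2].
  have eW2 : cell s2 vars vW = 4 ^ i by rewrite (fr_cell fr2).
  have eU2 : cell s2 vars vU = i * 4 by rewrite (fr_cell fr2).
  do 3! [apply: ok_seq; apply: ok_put => /=].
  apply: ok_seq; apply: ok_double => [|s3 fr3 /= eW3]; first exact: ltnW.
  apply: ok_put => /=.
  rewrite eW3 !(fr_cell fr3) //= eU2 eW2; split.
  + by rewrite [4 ^ i.+1]expnS mulnC.
  + by rewrite mulSn addnC.
  + by rewrite (fr_unread fr3).
  split=> x.
    by rewrite (fr_cell fr3) //= eL2 eL eW /litwt big_ord_recr /= nc.
  by rewrite (fr_cell fr3) //= (fr_cell fr2 (a := slack)) //= eS slackwtS eU2 eW2.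
- by move=> s1 _ [].
Qed.

Lemma ok_reduction K phi s :
  (forall a x, cell s a x = 0) -> unread s = encode_cnf3 phi -> printed s = [::] ->
  5 <= K -> nvars phi < K -> (nclauses phi).*2 < K ->
  nbits (nvars phi) <= K -> nbits (nclauses phi).*2 <= K ->
  gside (nvars phi) <= K -> gside (nclauses phi).*2 <= K ->
  ok K reduction s (fun s' => printed s' = encode_cmw (cmw_of phi)).
Proof.
move=> e0 eu ep K5 nK mK k1 k2 t1 t2.
have K2 : 2 < K by lia.
have mK' : nclauses phi <= K by lia.
apply: ok_seq; apply: ok_read.
apply: ok_seq; apply: ok_read.
apply: ok_seq; apply: (@ok_weaken _ _ _ _ _ (@ok_read_clauses K _ phi K2 mK' _ _ _)).
- by rewrite /= eu.
- by move=> b x; rewrite /= e0.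
- by rewrite /= eu.
move=> s1 fr1 [eL eS].
have eN1 : cell s1 vars vN = nvars phi by rewrite (fr_cell fr1) //= eu.
have eM1 : cell s1 vars vM = nclauses phi by rewrite (fr_cell fr1) //= eu.
have ep1 : printed s1 = [::] by rewrite (fr_printed fr1).
apply: ok_seq; apply: ok_weaken (ok_print_graph eN1 eL K5 nK k1 t1) _.
move=> s2 fr2 ep2.
have eM2 : cell s2 vars vM = nclauses phi by rewrite (fr_cell fr2).
have eS2 x : cell s2 slack x = slackwt (nclauses phi) x by rewrite (fr_cell fr2).
apply: ok_seq; apply: ok_put.
set s3 := put _ _ _ _.
have eN3 : cell s3 vars vN = (nclauses phi).*2 by rewrite /= eM2 addnn.
have eS3 x : cell s3 slack x = slackwt (nclauses phi) x by rewrite /= eS2.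
apply: ok_weaken (ok_print_graph eN3 eS3 K5 mK k2 t2) _ => s4 fr4 ->.
by rewrite /= ep2 ep1.
Qed.

Definition program_of (c : cmd) : program := compile c 0 0.

(** The output is inspected at time exactly [t], but a halted machine no longer moves, so every [t]
    above the cost will do. *)
Lemma run_program c s K inp :
  (forall a x, cell s a x = 0) -> unread s = inp -> printed s = [::] ->
  forall t out, ok K c s (fun s' => printed s' = out) -> cost c s <= t ->
  outputs_within (program_of c) inp t out.
Proof.
move=> e0 eu ep t out [_ eo] lt.
have ca : code_at (program_of c) 0 (compile c 0 0).
  by exists [::], [::]; rewrite cats0.
have [|X [[u ut eX] _ _]] := @compile_reach _ c 0 s 0 (fun=> 0) ca.
  by move=> a i; rewrite e0.
rewrite eu ep eo in eX.
have fix_end k cf : pc cf = size (program_of c) ->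
    iter k (step (program_of c)) cf = cf.
  move=> h; elim: k => //= k ->; rewrite /step h.
  by rewrite onth_default.
rewrite /outputs_within /= -(subnK (leq_trans ut lt)) iterD.
by rewrite [iter u _ _]eX fix_end // /halted /= leqnn.
Qed.

(** * Hall's theorem *)

Section Hall.

Variables (V W : finType) (w0 : W).

Lemma bigcup_setD (f : V -> {set W}) (S : {set V}) (X : {set W}) :
  \bigcup_(v in S) (f v :\: X) = (\bigcup_(v in S) f v) :\: X.
Proof.
apply/setP => w; rewrite inE; apply/bigcupP/andP.
  by case=> v vS /setDP[wf wX]; split=> //; apply/bigcupP; exists v.
by case=> wX /bigcupP[v vS wf]; exists v => //; apply/setDP.
Qed.

(** Induction on [A]. If a proper nonempty subset is tight, it and its complement are matched
    separately; otherwise any vertex may be matched to any of its neighbours. [w0] is the value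
    outside [A]. *)
Theorem hall (f : V -> {set W}) (A : {set V}) :
  (forall S : {set V}, S \subset A -> #|S| <= #|\bigcup_(v in S) f v|) ->
  exists2 g : V -> W, {in A &, injective g} & {in A, forall v, g v \in f v}.
Proof.
have [n] := ubnP #|A|; elim: n f A => // n IH f A; rewrite ltnS => An hall_f.
have [->|[v0 v0A]] := set_0Vmem A.
  by exists (fun=> w0) => [u v|v]; rewrite inE.
have [/existsP[S /and4P[SA S0 S'A tight]]|no_tight] :=
    boolP [exists S : {set V}, [&& S \subset A, S != set0, S != A &
                                  #|\bigcup_(v in S) f v| <= #|S|]].
  have ltS : #|S| < #|A| by apply: proper_card; rewrite properEneq S'A.
  have S_gt0 : 0 < #|S| by rewrite card_gt0.
  have [g1 inj1 gf1] := IH f S (leq_trans ltS An)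
    (fun S' sub => hall_f S' (subset_trans sub SA)).
  have cardD : #|A :\: S| = #|A| - #|S| by rewrite cardsDS.
  have [|S' S'sub|g2 inj2 gf2] :=
      IH (fun v => f v :\: \bigcup_(u in S) f u) (A :\: S); first by lia.
    rewrite bigcup_setD; set N := \bigcup_(u in S) f u in tight *.
    have /subsetDP[S'A1 dis] := S'sub.
    (* Hall's condition for [S' :|: S] loses at most [#|S|] neighbours when those of the tight set
       are removed. *)
    have := hall_f (S' :|: S); rewrite subUset S'A1 SA => /(_ isT).
    rewrite bigcup_setU -/N; set X := \bigcup_(u in S') f u.
    have := cardsUI X N; have := cardsID N X; have := cardsUI S' S.
    by move: dis; rewrite -setI_eq0 => /eqP->; rewrite cards0; lia.
  exists (fun v => if v \in S then g1 v else g2 v) => [u v uA vA|v vA].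
  - have n1 x y : x \in S -> y \notin S -> y \in A -> g1 x <> g2 y.
      move=> xS yS yA e; have : g2 y \in f y :\: \bigcup_(u in S) f u.
        by apply: gf2; rewrite inE yS.
      rewrite inE => /andP[/negP[]]; rewrite -e; apply/bigcupP.
      by exists x => //; apply: gf1.
    case: ifPn => uS; case: ifPn => vS e.
    + exact: inj1 e.
    + by case: (n1 u v).
    + by case: (n1 v u).
    + by apply: inj2 => //; rewrite inE ?uS ?vS.
  - case: ifPn => vS; first exact: gf1.
    by have := gf2 v; rewrite !inE vS vA => /(_ isT) /andP[].
have /card_gt0P[w wf] : 0 < #|f v0|.
  by have := hall_f [set v0]; rewrite sub1set cards1 big_set1 => /(_ v0A).
have [|S' S'sub|g inj gf] := IH (fun v => f v :\ w) (A :\ v0).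
- by move: An; rewrite (cardsD1 v0 A) v0A.
(* No subset is tight, so [S'] has a neighbour to spare and can lose [w]. *)
- rewrite bigcup_setD; have [->|S'0] := eqVneq S' set0; first by rewrite cards0.
  move: no_tight; rewrite negb_exists => /forallP /(_ S').
  have [S'A v0S'] := subsetD1P S'sub.
  have ne : S' != A by apply: contraNneq v0S' => ->.
  rewrite S'A S'0 ne /= -ltnNge.
  set N := \bigcup_(v in S') f v; rewrite (cardsD1 w N) => h.
  by case: (w \in N) h; lia.
exists (fun v => if v == v0 then w else g v) => [u v uA vA|v vA].
- have n1 y : y != v0 -> y \in A -> w <> g y.
    by move=> yv yA e; have := gf y; rewrite !inE yv yA e eqxx => /(_ isT).
  case: eqP => [->|/eqP uv]; case: eqP => [->|/eqP vv] // e.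
  + by case: (n1 v).
  + by case: (n1 u).
  + by apply: inj => //; rewrite !inE ?uv ?vv.
- case: eqP => [->//|/eqP vv].
  by have := gf v; rewrite !inE vv vA => /(_ isT) /andP[].
Qed.

End Hall.

(** * Almost pairwise independent classes *)

Lemma card_setI_bigcup (I W : finType) (C : I -> {set W}) (D : {set I}) (A : {set W}) :
  #|A :&: \bigcup_(i in D) C i| <= \sum_(i in D) #|A :&: C i|.
Proof.
elim/big_rec2: _ => [|i n X _ le]; first by rewrite setI0 cards0.
rewrite setIUr; apply: leq_trans (leq_card_setU _ _) _.
by rewrite leq_add2l.
Qed.

(** Adding the sets one by one, each contributes at least [M] minus its overlaps with the others.
    Counting ordered pairs avoids a division by two. *)
Lemma bonferroni (I W : finType) (C : I -> {set W}) (D : {set I}) M N :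
  {in D, forall i, M <= #|C i|} ->
  {in D &, forall i j, i != j -> #|C i :&: C j| <= N} ->
  #|D| * M <= #|\bigcup_(i in D) C i| + #|D| * #|D|.-1 * N.
Proof.
have [n] := ubnP #|D|; elim: n D => // n IH D; rewrite ltnS => Dn big small.
have [->|[d dD]] := set_0Vmem D; first by rewrite cards0.
have eD := cardsD1 d D; rewrite dD add1n in eD.
have := IH (D :\ d); rewrite eD /= in Dn *; move=> /(_ Dn) h.
have sub i : i \in D :\ d -> (i \in D) && (d != i).
  by rewrite !inE eq_sym andbC.
have {}h := h (fun i iD => big i (proj1 (andP (sub i iD))))
  (fun i j iD jD => small i j (proj1 (andP (sub i iD))) (proj1 (andP (sub j jD)))).
rewrite (big_setD1 d) //=; set U := \bigcup_(i in _) _ in h *.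
have cap : #|C d :&: U| <= #|D :\ d| * N.
  apply: leq_trans (card_setI_bigcup _ _ _) _.
  rewrite -sum_nat_const; apply: leq_sum => i /sub /andP[iD di].
  exact: small.
have := cardsUI (C d) U; have := big d dD.
set m := #|D :\ d| in h cap *.
case: m h cap => [|m] /=; nia.
Qed.

(** * Sums over residues and hits of arithmetic progressions *)

Lemma sum_divn_modn X Q (F : nat -> nat -> nat) : 0 < Q ->
  \sum_(w < X * Q) F (w %/ Q) (w %% Q) = \sum_(x < X) \sum_(y < Q) F x y.
Proof.
move=> Q0; rewrite -(big_mkord xpredT (fun w => F (w %/ Q) (w %% Q))) big_nat_mul.
rewrite big_mkord; apply: eq_bigr => x _.
rewrite -{1}[x * Q]add0n big_addn mulSn addnK big_mkord.
apply: eq_bigr => y _.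
by rewrite addnC divnMDl // modnMDl divn_small // modn_small // addn0.
Qed.

Lemma sum_rotate Q s (F : nat -> nat) : 0 < Q ->
  \sum_(y < Q) F ((y + s) %% Q) = \sum_(y < Q) F y.
Proof.
move=> Q0; elim: s => [|s IH].
  by apply: eq_bigr => y _; rewrite addn0 modn_small.
rewrite -IH; case: Q Q0 {IH} => // Q _.
rewrite big_ord_recr [RHS]big_ord_recl /= addnC; congr (_ + _).
  by rewrite add0n addnS -addSn modnDl.
by apply: eq_bigr => i _; rewrite /bump add1n addnS.
Qed.

Lemma sum_ltn_eq q a : \sum_(z < q) (val z == a) = (a < q).
Proof.
case: ltnP => [lt|le].
  rewrite (bigD1 (Ordinal lt)) //= eqxx big1 // => i.
  by rewrite -val_eqE /= => /negbTE->.
by rewrite big1 // => i _; case: eqP (ltn_ord i) => // ->; rewrite ltnNge le.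
Qed.

Lemma sum_class q c : c < q -> \sum_(z < q * q) (z %/ q == c) = q.
Proof.
move=> lt; rewrite (sum_divn_modn q (fun x _ => x == c)); last exact: leq_ltn_trans lt.
transitivity (\sum_(z < q) (val z == c) * q).
  by apply: eq_bigr => x _; rewrite sum_nat_const card_ord mulnC.
by rewrite -big_distrl /= sum_ltn_eq lt mul1n.
Qed.

(* Each hit claims the d integers from z + d * x on, which lie below A + q + d. *)
Lemma hits_window z d A q X :
  d * \sum_(x < X) (A <= z + d * x < A + q) <= minn (z + d * X) (A + q + d) - A.
Proof.
elim: X => [|X IH]; first by rewrite big_ord0 muln0.
rewrite big_ord_recr /= mulnDr mulnS; move: (d * _) IH => S IH.
case: andP => [[h1 h2]|_] /=; rewrite ?muln1 ?muln0; lia.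
Qed.

(** Every period of length [q * q] contains one window of length [q], which a progression of
    difference [d] hits at most [(q + d) / d] times. It remains to count the periods met. *)
Lemma hits_progression q X z d c : 0 < d < q -> c < q -> z < q * q -> q * q <= X ->
  q * \sum_(x < X) ((z + d * x) %% (q * q) %/ q == c) <= 6 * X.
Proof.
move=> /andP[d0 dq] cq zQ QX; set Q := q * q.
have q0 : 0 < q by apply: ltn_trans dq.
have Q0 : 0 < Q by rewrite muln_gt0 q0.
(* One extra period for the start [z < Q] and one for rounding. *)
pose U := (d * X) %/ Q + 2.
have step1 : \sum_(x < X) ((z + d * x) %% Q %/ q == c) <=
    \sum_(u < U) \sum_(x < X) (u * Q + c * q <= z + d * x < u * Q + c * q + q).
  rewrite exchange_big /=; apply: leq_sum => x _.
  case: eqP => // e.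
  have uU : (z + d * x) %/ Q < U.
    have : d * x <= d * X by rewrite leq_mul2l orbC ltnW.
    rewrite ltn_divLR // /U mulnDl.
    have := ltn_ceil (d * X) Q0; lia.
  rewrite (bigD1 (Ordinal uU)) //=.
  rewrite [X in nat_of_bool X](_ : _ = true) //.
  have eQ := divn_eq (z + d * x) Q; have er := divn_eq ((z + d * x) %% Q) q.
  have := ltn_pmod ((z + d * x) %% Q) q0.
  rewrite e in er; lia.
have step2 : d * \sum_(x < X) ((z + d * x) %% Q %/ q == c) <= U * (q + d).
  apply: (leq_trans (leq_mul (leqnn d) step1)).
  rewrite big_distrr /= -[U in leqRHS]card_ord -sum_nat_const.
  apply: leq_sum => u _; apply: leq_trans (hits_window _ _ _ _ _) _; lia.
have hU : U * Q <= d * X + 2 * Q by rewrite mulnDl leq_add2r leq_divM.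
rewrite -(leq_pmul2l d0) -(leq_pmul2l q0).
set S := \sum_(x < X) _ in step2 *.
have h1 : q * (d * (q * S)) <= Q * (U * (q + d)).
  by rewrite /Q -mulnA leq_mul2l mulnCA leq_mul2l step2 !orbT.
have h2 : Q * (U * (q + d)) <= (d * X + 2 * Q) * (2 * q).
  rewrite mulnA [Q * U]mulnC leq_mul //; lia.
apply: (leq_trans h1); apply: (leq_trans h2).
(* [Q <= X] absorbs the two extra periods: [(d * X + 2 * d * X) * (2 * q)] gives the constant 6. *)
have : 2 * Q <= 2 * (d * X) by rewrite leq_mul2l /=; nia.
nia.
Qed.

Section Classes.

Variables (q X : nat).
Hypotheses (q0 : 0 < q) (QX : q * q <= X).
Let Q := q * q.
Let Q0 : 0 < Q. Proof. by rewrite muln_gt0 q0. Qed.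

(** The columns that give label [c] to a vertex of slope [a]. *)
Definition cls (a c : nat) : {set 'I_(X * Q)} :=
  [set w : 'I_(X * Q) | (w + a * (w %/ Q)) %% Q %/ q == c].

Lemma card_div_mod (P : nat -> nat -> bool) :
  #|[set w : 'I_(X * Q) | P (w %/ Q) (w %% Q)]| = \sum_(x < X) \sum_(y < Q) P x y.
Proof.
rewrite -(sum_divn_modn X (fun x y => nat_of_bool (P x y)) Q0) -sum1dep_card big_mkcond.
by apply: eq_bigr => w _; case: (P _ _).
Qed.

(** In each of the [X] blocks the slope only rotates the residues modulo [Q], and [q] of these have
    label [c]. *)
Lemma card_cls a c : c < q -> #|cls a c| = X * q.
Proof.
move=> lt; rewrite /cls.
rewrite (_ : [set w | _] = [set w : 'I_(X * Q) |
   ((w %% Q) + a * (w %/ Q)) %% Q %/ q == c]); last first.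
  by apply/setP => w; rewrite !inE modnDml.
rewrite (card_div_mod (fun x y => (y + a * x) %% Q %/ q == c)).
rewrite -[X in RHS]card_ord -sum_nat_const; apply: eq_bigr => x _.
rewrite (sum_rotate (a * x) (fun z => nat_of_bool (z %/ q == c)) Q0).
exact: sum_class.
Qed.

(** Let [z] be the offset for the smaller slope. For each of the [q] values of [z] with label [c'],
    the offsets for the other slope form a progression of difference [a - a'], which has label [c]
    at most [6 * X / q] times. *)
Lemma card_clsI a a' c c' : a < q -> a' < q -> c < q -> c' < q -> a != a' ->
  #|cls a c :&: cls a' c'| <= 6 * X.
Proof.
wlog lt : a a' c c' / a' < a => [hwlog|].
  move=> h1 h2 h3 h4 ne; case: (ltngtP a a') => [lt|lt|e].
  - by rewrite setIC; apply: hwlog; rewrite // eq_sym.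
  - exact: hwlog.
  - by rewrite e eqxx in ne.
move=> aq _ cq c'q _.
rewrite (_ : _ :&: _ = [set w : 'I_(X * Q) |
   (((w %% Q) + a * (w %/ Q)) %% Q %/ q == c) &&
   (((w %% Q) + a' * (w %/ Q)) %% Q %/ q == c')]); last first.
  by apply/setP => w; rewrite !inE !modnDml.
rewrite (card_div_mod (fun x y => ((y + a * x) %% Q %/ q == c) &&
                              ((y + a' * x) %% Q %/ q == c'))).
set d := a - a'.
have -> : \sum_(x < X) \sum_(y < Q) (((y + a * x) %% Q %/ q == c) &&
                              ((y + a' * x) %% Q %/ q == c') : nat) =
  \sum_(x < X) \sum_(z < Q) (((z + d * x) %% Q %/ q == c) && (z %/ q == c') : nat).
  apply: eq_bigr => x _.
  rewrite -(sum_rotate (a' * x) (fun z =>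
    nat_of_bool (((z + d * x) %% Q %/ q == c) && (z %/ q == c'))) Q0).
  apply: eq_bigr => y _; rewrite modnDml -addnA -mulnDl.
  by rewrite subnKC // ltnW.
rewrite exchange_big /= -(leq_pmul2l q0) big_distrr /=.
apply: (@leq_trans (\sum_(z < Q) (z %/ q == c') * (6 * X))).
  apply: leq_sum => z _; case: (z %/ q == c'); last first.
    by rewrite big1 ?muln0 // => x _; rewrite andbF.
  rewrite mul1n; under eq_bigr do rewrite andbT.
  by apply: hits_progression => //; rewrite subn_gt0 lt (leq_ltn_trans (leq_subr _ _)).
by rewrite -big_distrl /= sum_class.
Qed.

Lemma cls_disjoint a c c' : c != c' -> cls a c :&: cls a c' = set0.
Proof.
move=> ne; apply/setP => w; rewrite !inE; apply/negP => /andP[/eqP-> /eqP e].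
by rewrite e eqxx in ne.
Qed.

(** Hall's theorem with the admissible columns as neighbours. Vertices from [Q * J] on are
    unconstrained, so a set containing one sees every column; any other set is grouped by slope and
    label, and a few of the resulting classes already cover enough. *)
Lemma spread (J : nat) (alpha : nat -> nat) :
  1 < q -> 24 * (Q * J) <= X * Q -> (forall v, alpha v < q) ->
  exists2 g : 'I_(X * Q) -> 'I_(X * Q), injective g &
    forall v : 'I_(X * Q), v < Q * J -> (g v + v %% q * (g v %/ Q)) %% Q %/ q = alpha v.
Proof.
move=> q1 NX al.
have X0 : 0 < X by apply: leq_trans QX.
have t0 : 0 < X * Q by rewrite muln_gt0 X0.
pose f (v : 'I_(X * Q)) := if v < Q * J then cls (v %% q) (alpha v) else setT.
have [|g gi gf] := @hall _ _ (Ordinal t0) f setT; last first.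
- exists g; first by move=> u v; apply: gi; rewrite inE.
  by move=> v vN; have := gf v; rewrite inE /f vN => /(_ isT); rewrite inE => /eqP.
move=> S _.
have [/exists_inP[v vS vN]|] := boolP [exists v in S, Q * J <= v].
  apply: subset_leq_card; apply: (subset_trans (subsetT S)).
  apply: (bigcup_max v) => //.
  by rewrite /f ltnNge vN.
rewrite negb_exists_in => /forall_inP small.
pose h (v : 'I_(X * Q)) := (Ordinal (ltn_pmod v q0), Ordinal (al v)).
pose C (p : 'I_q * 'I_q) := cls p.1 p.2.
have fh v : v \in S -> f v = C (h v) by move=> vS; rewrite /f ltnNge small.
pose D := h @: S.
have -> : \bigcup_(v in S) f v = \bigcup_(p in D) C p.
  apply/setP => w; apply/bigcupP/bigcupP => [[v vS wf]|[p /imsetP[v vS ->] wC]].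
    by exists (h v); [exact: imset_f|rewrite -fh].
  by exists v => //; rewrite fh.
(* Each slope occurs [q * J] times among the first [Q * J] vertices, which bounds the fibres of
   [h]. *)
have SD : #|S| <= #|D| * (q * J).
  rewrite -sum1_card (partition_big_imset h) /= -sum_nat_const.
  apply: leq_sum => p _.
  apply: (@leq_trans (\sum_(v < X * Q | v < Q * J) (v %% q == p.1))).
    rewrite [leqRHS]big_mkcond [leqLHS]big_mkcond; apply: leq_sum => v _.
    case: ifP => // /andP[vS /eqP <-] /=.
    have -> : v < Q * J by rewrite ltnNge small.
    by rewrite eqxx.
  have le : Q * J <= X * Q by lia.
  rewrite -(big_ord_widen _ (fun v => nat_of_bool (v %% q == p.1)) le).
  rewrite /Q -mulnA [q * _]mulnC.
  rewrite (sum_divn_modn (q * J) (fun _ x => nat_of_bool (x == p.1)) q0).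
  by rewrite sum_ltn_eq sum_nat_const card_ord ltn_ord muln1.
(* With at most [r] classes, the overlaps in Bonferroni's inequality cost at most half of the main
   term; yet [12 * r] exceeds [q]. *)
pose r := (q %/ 12).+1.
have [e [e_le e_r e_D]] : exists e, [/\ e <= #|D|, e <= r & (e = #|D| \/ e = r)].
  case: (leqP #|D| r) => le; first by exists #|D|; split; [| |left].
  by exists r; split; [exact: ltnW| |right].
have /card_geqP[s [us ss sD]] := e_le.
pose E := [set p in s].
have cE : #|E| = e by rewrite cardsE (card_uniqP us).
have ED : E \subset D by apply/subsetP => p; rewrite inE; apply: sD.
have : #|\bigcup_(p in E) C p| <= #|\bigcup_(p in D) C p|.
  apply: subset_leq_card; apply/bigcupsP => p pE.
  by apply: bigcup_sup; apply: (subsetP ED).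
apply: leq_trans.
have bonf : #|E| * (X * q) <= #|\bigcup_(p in E) C p| + #|E| * #|E|.-1 * (6 * X).
  apply: bonferroni => [p _|p p' _ _ ne]; first by rewrite card_cls.
  have [e1|ne1] := eqVneq p.1 p'.1; last exact: card_clsI.
  rewrite /C e1 cls_disjoint ?cards0 //; apply: contra ne => /eqP e2.
  by apply/eqP; case: p p' e1 e2 => [a b] [a' b'] /= -> /val_inj ->.
rewrite cE in bonf.
have r12 : 12 * e.-1 <= q.
  by have := leq_divM q 12; rewrite -/r in e_r *; rewrite /r in e_r; lia.
have half : e * (X * q) <= 2 * #|\bigcup_(p in E) C p|.
  have : e * (e.-1 * (12 * X)) <= e * (X * q) by rewrite leq_mul2l; nia.
  nia.
have N24 : 24 * (q * J) <= X * q by move: NX; rewrite /Q; nia.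
have qJX : 2 * (q * J) <= X * q by lia.
(* If all classes were taken, the union is compared with the bound on [#|S|] by fibres. Otherwise it
   contains at least 1/24 of all columns, hence at least [Q * J]. *)
case: e_D => [eD|er].
  have : #|D| * (2 * (q * J)) <= e * (X * q) by rewrite eD leq_mul2l qJX orbT.
  lia.
have SN : #|S| <= Q * J.
  have le : Q * J <= X * Q by lia.
  apply: (@leq_trans (\sum_(v < X * Q | v < Q * J) 1)).
    rewrite -sum1_card [leqRHS]big_mkcond [leqLHS]big_mkcond; apply: leq_sum => v _.
    by case: ifP => // vS; rewrite (_ : v < Q * J) // ltnNge small.
  by rewrite -(big_ord_widen _ (fun=> 1) le) sum_nat_const card_ord muln1.
have rq : q <= 12 * e by rewrite er; have := ltn_ceil q (isT : 0 < 12); lia.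
have : X * Q <= 12 * (e * (X * q)) by rewrite /Q; nia.
lia.
Qed.

End Classes.

(** * Matching weights of the gadget *)

Lemma matching_fun (G : wgraph) (M : {set edge G}) : perfect_matching M ->
  exists p : 'I_(side G) -> 'I_(side G),
    matching_weight M = \sum_v weight v (p v).
Proof.
case/andP=> /forallP row _.
have ex v : exists w, [set e in M | e.1 == v] = [set (v, w)].
  have /cards1P[[v' w] e] := row v; exists w.
  have : (v', w) \in [set e in M | e.1 == v] by rewrite e set11.
  by rewrite inE => /andP[_ /eqP /= v'v]; rewrite e v'v.
have [p hp] := fin_all_exists ex; exists p.
rewrite /matching_weight (partition_big fst xpredT) //=; apply: eq_bigr => v _.
rewrite (eq_bigl (fun e => e \in [set e in M | e.1 == v])); last by move=> e; rewrite inE.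
by rewrite hp big_set1.
Qed.

Lemma fun_matching (G : wgraph) (p : 'I_(side G) -> 'I_(side G)) : injective p ->
  exists2 M : {set edge G}, perfect_matching M &
    matching_weight M = \sum_v weight v (p v).
Proof.
move=> pI; pose M := [set (v, p v) | v in 'I_(side G)].
have inM e : (e \in M) = (e.2 == p e.1).
  apply/imsetP/eqP => [[v _ ->]//|h]; exists e.1 => //.
  by rewrite -h; case: (e).
have [p' pK p'K] := injF_bij pI.
exists M.
  apply/andP; split; apply/forallP => v; apply/cards1P.
    exists (v, p v); apply/setP => -[x y]; rewrite !inE inM /= xpair_eqE andbC.
    by case: eqP => // ->.
  exists (p' v, v); apply/setP => -[x y]; rewrite !inE inM /= xpair_eqE andbC.
  by case: eqP => [->|_]; rewrite ?andbF ?andbT // -[x == _](inj_eq pI) p'K eq_sym.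
rewrite /matching_weight big_imset /=; first by apply: eq_bigl.
by move=> u v _ _ [].
Qed.

Lemma bits_exist k (a : nat -> bool) :
  exists2 c, c < 2 ^ k & forall i, i < k -> odd (c %/ 2 ^ i) = a i.
Proof.
elim: k a => [|k IH] a; first by exists 0.
have [c c_lt hc] := IH (fun i => a i.+1).
exists (a 0 + c.*2); first by rewrite expnS; case: (a 0); lia.
case=> [_|i ik]; first by rewrite divn1 oddD odd_double addbF oddb.
rewrite expnS divnMA divn2 halfD odd_double andbF add0n doubleK.
by rewrite (_ : (a 0 : nat)./2 = 0) ?hc //; case: (a 0).
Qed.

Section Gadget.

Variables (T : nat -> nat) (n : nat).
(** The vertices carry more than [n] bits; this makes the surplus ones weightless. *)
Hypothesis T0 : forall j, n <= j./2 -> T j = 0.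

Let k := nbits n.
Let q := width n.

Lemma nrep_gt : n < period n * nrep n * nbits n.
Proof.
have M0 : 0 < period n * nbits n by rewrite muln_gt0 period_gt0.
by rewrite mulnAC mulnC; apply: ltn_ceil.
Qed.

Lemma side_ge : 24 * (period n * nrep n) <= gside n.
Proof. by rewrite /gside mulnDl; nia. Qed.

Lemma sum_items (b : nat -> nat -> bool) :
  \sum_(v < gside n) \sum_(i < k) T ((v * k + i).*2 + b v i) =
  \sum_(j < n) T (j.*2 + b (j %/ k) (j %% k)).
Proof.
have k0 : 0 < k by [].
rewrite -(sum_divn_modn (gside n) (fun v i => T ((v * k + i).*2 + b v i)) k0).
under eq_bigr do rewrite -divn_eq.
have le : n <= gside n * k.
  apply: leq_trans (ltnW nrep_gt) _; rewrite leq_mul2r; apply/orP; right.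
  by apply: leq_trans side_ge; lia.
rewrite -[LHS](big_mkord xpredT (fun j => T (j.*2 + b (j %/ k) (j %% k)))).
rewrite (@big_cat_nat _ _ _ n) //= big_mkord [X in _ + X]big_nat_cond.
rewrite [X in _ + X]big1 ?addn0 //.
move=> j; rewrite andbT => /andP[nj _]; apply: T0.
by case: (b _ _); rewrite ?addn1 ?addn0 ?uphalf_double /= ?doubleK ?uphalf_double.
Qed.

(** A matching gives bits by reading its labels. Conversely, the bits of each block form a label,
    and [spread] realises all these labels by one permutation. *)
Lemma gadget_weights (x : nat) :
  (exists2 M : {set edge (gadget T n)}, perfect_matching M & matching_weight M = x)
  <-> exists a : nat -> bool, x = \sum_(j < n) T (j.*2 + a j).
Proof.
split=> [[M /matching_fun[p ->] <-]|[a ->]].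
  (* The default 0 only serves indices [v] that are not vertices. *)
  pose b v i := odd (offset n v (if insub v is Some v' then p v' else 0) %/ (q * 2 ^ i)).
  exists (fun j => b (j %/ k) (j %% k)); rewrite -sum_items.
  apply: eq_bigr => v _; apply: eq_bigr => i _.
  by rewrite /b valK.
have ex v : exists c, c < q /\ forall i, i < k -> odd (c %/ 2 ^ i) = a (v * k + i).
  by have [c c1 c2] := bits_exist k (fun i => a (v * k + i)); exists c.
have [al hal] : exists al : nat -> nat,
    forall v, al v < q /\ forall i, i < k -> odd (al v %/ 2 ^ i) = a (v * k + i).
  pose P v c := (c < q) && [forall i : 'I_k, odd (c %/ 2 ^ i) == a (v * k + i)].
  have exP v : exists c, P v c.
    have [c [c1 c2]] := ex v; exists c; rewrite /P c1.
    by apply/forallP => i; rewrite c2.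
  exists (fun v => xchoose (exP v)) => v; have /andP[h1 /forallP h2] := xchooseP (exP v).
  by split=> // i ik; apply/eqP; apply: (h2 (Ordinal ik)).
have q1 : 1 < q by rewrite /q /width /nbits expnS; have := expn_gt0 2 (trunc_log 32 n); lia.
have [g gI hg] := @spread q (reps n) (width_gt0 n) (leq_addr _ _) (nrep n) al q1
  side_ge (fun v => proj1 (hal v)).
have [M pM wM] := @fun_matching (gadget T n) g gI.
exists M => //; rewrite wM.
pose b v i := a (v * k + i).
transitivity (\sum_(v < gside n) \sum_(i < k) T ((v * k + i).*2 + b v i)); last first.
  by rewrite sum_items; apply: eq_bigr => j _; rewrite /b -divn_eq.
apply: eq_bigr => v _; apply: eq_bigr => i _.
(* Unconstrained vertices hold only items from [n] on, whose weights vanish. *)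
case: (ltnP v (q * q * nrep n)) => vN.
  rewrite divnMA /offset -/q -/(q * q) (hg v vN).
  by have [_ ->] := hal v.
have nv : n <= v * k + i.
  apply: leq_trans (leq_addr _ _); apply: (leq_trans (ltnW nrep_gt)).
  by rewrite leq_mul2r vN orbT.
have half (m : nat) (c : bool) : (m.*2 + c)./2 = m.
  by case: c; rewrite ?addn1 ?addn0 /= ?uphalf_double ?doubleK.
by rewrite !T0 ?half.
Qed.

End Gadget.

(** * Correctness and size of the reduction *)

Lemma digits_lt m (x : nat -> nat) : (forall j, j < m -> x j < 4) ->
  \sum_(j < m) 4 ^ j * x j < 4 ^ m.
Proof.
elim: m => [|m IH] lt4; first by rewrite big_ord0.
have := IH (fun j h => lt4 j (ltnW h)); have := lt4 m (ltnSn m).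
rewrite big_ord_recr expnS /= => h1 h2; nia.
Qed.

Lemma digits_inj m (x y : nat -> nat) :
  (forall j, j < m -> x j < 4) -> (forall j, j < m -> y j < 4) ->
  \sum_(j < m) 4 ^ j * x j = \sum_(j < m) 4 ^ j * y j ->
  forall j, j < m -> x j = y j.
Proof.
elim: m => [|m IH] // x4 y4; rewrite !big_ord_recr /= => e.
have x4' j : j < m -> x j < 4 by move=> h; apply: x4; apply: ltnW.
have y4' j : j < m -> y j < 4 by move=> h; apply: y4; apply: ltnW.
have lx := digits_lt x4'; have ly := digits_lt y4'.
have xy : x m = y m.
  case: (ltngtP (x m) (y m)) => // lt;
    move: (leq_mul (leqnn (4 ^ m)) lt) lx ly e; rewrite mulnS;
    move: (4 ^ m) (_ * x m) (_ * y m) (\sum_(j < m) _) (\sum_(j < m) _);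
    move=> P p1 p2 s1 s2; lia.
rewrite xy in e; move=> j; rewrite ltnS leq_eqVlt => /predU1P[-> //|jm].
exact: (IH x4' y4' (addIn e)) jm.
Qed.

(** An occurrence of [l] can be matched only by its own variable, and is so exactly when [l] is
    true. *)
Lemma clause_count n (a : nat -> bool) (cl : seq (literal n)) :
  \sum_(i < n) count_mem (i.*2 + a i) (map (@lit_code n) cl) =
  count (fun l : literal n => a l.1 == l.2) cl.
Proof.
elim: cl => [|l cl IH] /=; first by rewrite big1.
rewrite big_split /= IH; congr (_ + _).
rewrite (bigD1 l.1) //= big1 ?addn0.
  by congr nat_of_bool; rewrite /lit_code eqn_add2l; case: (a _) (l.2) => [] [].
move=> i ne; rewrite /lit_code; case: eqP => // e; case/eqP: ne; apply: val_inj => /=.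
by case: (a i) (l.2) e => [] []; lia.
Qed.

Definition true_lits (phi : cnf3) (a : nat -> bool) (j : nat) : nat :=
  \sum_(i < nvars phi) count_mem (i.*2 + a i) (nth [::] (codes phi) j).

Lemma size_codes phi : size (codes phi) = nclauses phi.
Proof. exact: size_map. Qed.

Lemma satisfies_true_lits phi (a : nat -> bool) :
  satisfies (fun i : 'I_(nvars phi) => a i) <->
  forall j, j < nclauses phi -> 0 < true_lits phi a j.
Proof.
rewrite /satisfies (eq_all (a2 := preim (fun cl => map (@lit_code _) (tval cl))
  (fun c => 0 < \sum_(i < nvars phi) count_mem (i.*2 + a i) c))).
  rewrite -all_map -size_codes; split=> [/(all_nthP [::])//|h].
  exact/(all_nthP [::]).
by move=> cl /=; rewrite clause_count has_count.
Qed.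

Lemma true_lits_le3 phi a j : j < nclauses phi -> true_lits phi a j < 4.
Proof.
move=> jm; have [cl [_ ncl]] :=
  drop_nth_map (fun cl => map (@lit_code _) (tval cl)) [::] jm.
rewrite /true_lits ncl clause_count ltnS.
by apply: leq_trans (count_size _ _) _; rewrite size_tuple.
Qed.

Lemma litwt_out phi m j : nvars phi <= j./2 -> litwt (codes phi) m j = 0.
Proof.
move=> le; rewrite /litwt big1 // => i _.
case: (ltnP i (nclauses phi)) => im; last by rewrite nth_default ?size_codes ?muln0.
have [cl [_ ncl]] := drop_nth_map (fun cl => map (@lit_code _) (tval cl)) [::] im.
rewrite ncl (count_memPn _) ?muln0 //; apply/mapP => -[l _ e].
have := ltn_ord l.1; rewrite ltnNge => /negP; apply; apply: (leq_trans le).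
by rewrite e /lit_code; case: l.2; rewrite ?addn1 ?addn0 /= ?uphalf_double ?doubleK.
Qed.

Lemma sum_litwt phi (a : nat -> bool) :
  \sum_(i < nvars phi) litwt (codes phi) (nclauses phi) (i.*2 + a i) =
  \sum_(j < nclauses phi) 4 ^ j * true_lits phi a j.
Proof.
rewrite /litwt exchange_big /=; apply: eq_bigr => j _.
by rewrite /true_lits big_distrr.
Qed.

Lemma slackwt_out m j : m.*2 <= j./2 -> slackwt m j = 0.
Proof. by move=> le; rewrite /slackwt ltnNge (_ : m <= j %/ 4) //; lia. Qed.

Lemma sum_slackwt m (b : nat -> bool) :
  \sum_(i < m.*2) slackwt m (i.*2 + b i) =
  \sum_(j < m) 4 ^ j * (1 + b j.*2 + b j.*2.+1).
Proof.
rewrite -[m.*2]muln2.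
transitivity (\sum_(j < m) \sum_(y < 2) slackwt m ((j * 2 + y).*2 + b (j * 2 + y))).
  rewrite -(sum_divn_modn m (fun x y => slackwt m ((x * 2 + y).*2 + b (x * 2 + y)))) //.
  by apply: eq_bigr => i _; rewrite -divn_eq.
apply: eq_bigr => j _.
rewrite !big_ord_recl big_ord0 /= /bump /= addn0 addn1 !addn0 muln2.
have val r : r < 4 -> slackwt m (j * 4 + r) = 4 ^ j * nth 0 [:: 1; 2; 0; 1] r.
  by move=> r4; rewrite /slackwt divnMDl // modnMDl divn_small // addn0 modn_small ?ltn_ord.
rewrite (_ : j.*2.*2 + b j.*2 = j * 4 + b j.*2); last by lia.
rewrite (_ : j.*2.+1.*2 + b j.*2.+1 = j * 4 + (2 + b j.*2.+1)); last by lia.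
by rewrite !val; case: (b _); case: (b _) => //=; lia.
Qed.

Lemma cmw_of_correct phi : cmw_yes (cmw_of phi) <-> satisfiable phi.
Proof.
have gw1 := gadget_weights (@litwt_out phi (nclauses phi)).
have gw2 := gadget_weights (@slackwt_out (nclauses phi)).
have digit_slack (b : nat -> bool) j : 1 + b j.*2 + b j.*2.+1 < 4.
  by case: (b _); case: (b _).
split=> [[M1 [M2 [p1 p2 e]]]|[a0 sat]].
  have [a ea] := (gw1 _).1 (ex_intro2 _ _ M1 p1 erefl).
  have [b eb] := (gw2 _).1 (ex_intro2 _ _ M2 p2 erefl).
  move: e; rewrite ea eb sum_litwt sum_slackwt => e.
  exists (fun i => a i); apply/satisfies_true_lits => j jm.
  (* All digits are below 4, so equal weights have equal digits, and every slack digit is at least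
     1. *)
  have -> // := digits_inj (x := true_lits phi a)
    (y := fun j => 1 + b j.*2 + b j.*2.+1) _ _ e jm.
  by move=> i; apply: true_lits_le3.
pose a i := if insub i is Some i' then a0 i' else false.
have {}sat : satisfies (fun i : 'I_(nvars phi) => a i).
  apply: etrans sat; apply: eq_all => cl; apply: eq_has => l /=.
  by rewrite /a valK.
have /satisfies_true_lits pos := sat.
(* A count [t] in {1, 2, 3} is 1 plus the truth values of [1 < t] and [2 < t]. *)
pose b i := if odd i then 2 < true_lits phi a i./2 else 1 < true_lits phi a i./2.
have [M1 p1 w1] := (gw1 _).2 (ex_intro _ a erefl).
have [M2 p2 w2] := (gw2 _).2 (ex_intro _ b erefl).
exists M1, M2; split=> //; rewrite w1 w2 sum_litwt sum_slackwt.
apply: eq_bigr => j _; congr (_ * _).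
rewrite /b /= odd_double /= uphalf_double doubleK.
have := pos j (ltn_ord j); have := true_lits_le3 a (ltn_ord j).
by case: (true_lits phi a j) => [|[|[|[|]]]].
Qed.

(** Every matching weight is a base-4 number with one digit per clause, hence below
    [4 ^ nclauses phi]. *)
Lemma cmw_of_weights phi :
  (forall M : {set edge (cmw_of phi).1}, perfect_matching M ->
     matching_weight M <= 2 ^ (3 * nclauses phi)) /\
  (forall M : {set edge (cmw_of phi).2}, perfect_matching M ->
     matching_weight M <= 2 ^ (3 * nclauses phi)).
Proof.
have le : 4 ^ nclauses phi <= 2 ^ (3 * nclauses phi).
  by rewrite -[4]/(2 ^ 2) -expnM leq_pexp2l // leq_mul2r orbT.
split=> M pM; apply: leq_trans le; apply: ltnW.
- have [a ->] := (gadget_weights (@litwt_out phi (nclauses phi)) _).1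
    (ex_intro2 _ _ M pM erefl).
  by rewrite sum_litwt; apply: digits_lt => j; apply: true_lits_le3.
- have [b ->] := (gadget_weights (@slackwt_out (nclauses phi)) _).1
    (ex_intro2 _ _ M pM erefl).
  rewrite sum_slackwt; apply: (@digits_lt _ (fun j => 1 + b j.*2 + b j.*2.+1)) => j _.
  by case: (b _); case: (b _).
Qed.

(** * Size of the graphs and running time *)

Lemma width_pow5 n : width n ^ 5 = 32 ^ nbits n.
Proof. by rewrite /width -expnM mulnC expnM. Qed.

Lemma lt_pow_nbits n : n < 32 ^ nbits n.
Proof. exact: trunc_log_ltn. Qed.

(** The product is [q^4 k + 24 J q^2 k]. From [k <= q] and [q^5 <= 32 n], the first term is at most
    [32 n], and [J q^2 k <= n + q^2 k <= 33 n]; finally 32 + 24 * 33 = 824. *)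
Lemma gside_nbits n : 0 < n -> gside n * nbits n <= 824 * n.
Proof.
move=> n0.
have q5 : width n ^ 5 <= 32 * n.
  by rewrite width_pow5 /nbits expnS leq_mul2l trunc_logP.
have kq : nbits n <= width n by apply: ltnW; apply: ltn_expl.
have q0 := width_gt0 n.
have hJ : period n * nrep n * nbits n <= n + period n * nbits n.
  rewrite mulnAC /nrep mulnS addnC leq_add2r mulnC; exact: leq_divM.
set q := width n in q5 kq q0 *; set k := nbits n in kq hJ *.
set J := nrep n in hJ *; have eP : period n = q * q by [].
have q3 : q * q * k <= 32 * n.
  apply: leq_trans q5; apply: leq_trans (_ : q ^ 3 <= _); last by rewrite leq_pexp2l.
  by rewrite !expnSr expn0 mul1n leq_mul2l kq orbT.
have q4 : q * q * (q * q) * k <= 32 * n.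
  by apply: leq_trans q5; rewrite !expnSr expn0 mul1n !mulnA leq_mul2l kq orbT.
rewrite /gside /reps -/J eP in hJ *; nia.
Qed.

Lemma gside_le n : gside n <= 1000 * n.+1.
Proof.
case: (posnP n) => [->|n0]; first by rewrite /gside /reps /nrep /period /width /nbits.
have : gside n <= gside n * nbits n by rewrite leq_pmulr.
have := gside_nbits n0; lia.
Qed.

Lemma nbits_le_gside n : nbits n <= gside n.
Proof.
apply: (@leq_trans (width n)); first by apply: ltnW; apply: ltn_expl.
apply: (@leq_trans (period n)); first by rewrite leq_pmulr ?width_gt0.
by rewrite leq_pmull // addn_gt0 period_gt0.
Qed.

Lemma INR_exp2 j : (INR (2 ^ j) <= exp (INR j))%coq_R.
Proof.
elim: j => [|j IH]; first by rewrite expn0 /= exp_0; lra.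
rewrite expnS -multE mult_INR [INR j.+1]S_INR exp_plus Rmult_comm.
have := exp_ineq1_le 1; have := pos_INR (2 ^ j); rewrite /=; nra.
Qed.

(** From [n <= 2 ^ (5 * k) <= exp (5 * k)] follows [ln n <= 5 * k]; the constant 10 is this 5 times
    the two sides of the graph. *)
Lemma side_bound (G : wgraph) (k C n : nat) : 1 < n -> n <= 32 ^ k ->
  side G * k <= C * n ->
  (INR (nvertices G) <= INR (10 * C) * (INR n / ln (INR n)))%coq_R.
Proof.
move=> n1 nk sk; rewrite /nvertices card_sum !card_ord.
have hn1 : (1 < INR n)%coq_R by apply: (lt_INR 1); apply/ltP.
have hln : (0 < ln (INR n))%coq_R by rewrite -ln_1; apply: ln_increasing; lra.
have hk : (ln (INR n) <= INR (5 * k))%coq_R.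
  apply: Rnot_lt_le => /exp_increasing; rewrite exp_ln; last lra.
  apply: Rle_not_lt; apply: Rle_trans (INR_exp2 _); apply: le_INR; apply/leP.
  by rewrite expnM.
have hs : (INR (side G) * INR k <= INR C * INR n)%coq_R.
  by rewrite -!mult_INR; apply: le_INR; apply/leP.
apply: (Rmult_le_reg_r (ln (INR n))) => //.
have -> : (INR (10 * C) * (INR n / ln (INR n)) * ln (INR n) = INR (10 * C) * INR n)%coq_R.
  by field; lra.
rewrite -!multE -plusE !mult_INR plus_INR in hk *.
have s0 := pos_INR (side G).
have e5 : INR 5 = 5%coq_R by rewrite /=; lra.
have e10 : INR 10 = 10%coq_R by rewrite /=; lra.
rewrite e5 in hk; rewrite e10; nra.
Qed.

Lemma cmw_of_poly_time : poly_time cnf3_size encode_cnf3 encode_cmw cmw_of.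
Proof.
have [C [D hC]] := cost_safe reduction.
exists (program_of reduction), (C * 2001 ^ D), D => phi.
pose s := Store (fun _ _ => 0) (encode_cnf3 phi) [::].
(* The second graph is built from twice as many items as clauses, so [gside_le] bounds both sides by
   [K], and with them all loop counts; 2001 comes from [K.+1 <= 2001 * N.+1]. *)
set N := cnf3_size phi; pose K := 2000 * N.+1.
have [nN mN] : nvars phi <= N /\ nclauses phi <= N by rewrite /N /cnf3_size; lia.
have t1 : gside (nvars phi) <= K.
  by apply: leq_trans (gside_le _) _; rewrite /K; lia.
have t2 : gside (nclauses phi).*2 <= K.
  by apply: leq_trans (gside_le _) _; rewrite /K; lia.
have k1 := leq_trans (nbits_le_gside _) t1.
have k2 := leq_trans (nbits_le_gside _) t2.
have okr : ok K reduction s (fun s' => printed s' = encode_cmw (cmw_of phi)).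
  by apply: ok_reduction => //; rewrite /K; lia.
apply: (run_program (s := s) _ _ _ okr) => //.
apply: (leq_trans (hC K s okr.1)).
rewrite -mulnA -expnMn leq_mul2l; apply/orP; right.
case: (posnP D) => [->//|D0].
by rewrite (leq_exp2r _ _ D0) mulSn -add1n leq_add2r.
Qed.

Theorem theorem1 :
  exists f : cnf3 -> cmw_instance,
    poly_time cnf3_size encode_cnf3 encode_cmw f /\
    (forall phi : cnf3, cmw_yes (f phi) <-> satisfiable phi) /\
    (exists C : R, forall phi : cnf3, 2 <= nvars phi ->
       (INR (nvertices (f phi).1)
          <= C * (INR (nvars phi) / ln (INR (nvars phi))))%coq_R) /\
    (exists C : R, forall phi : cnf3, 2 <= nclauses phi ->
       (INR (nvertices (f phi).2)
          <= C * (INR (nclauses phi) / ln (INR (nclauses phi))))%coq_R) /\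
    (forall phi : cnf3,
       (forall M : {set edge (f phi).1}, perfect_matching M ->
          matching_weight M <= 2 ^ (3 * nclauses phi)) /\
       (forall M : {set edge (f phi).2}, perfect_matching M ->
          matching_weight M <= 2 ^ (3 * nclauses phi))).
Proof.
exists cmw_of; split; first exact: cmw_of_poly_time.
split; first exact: cmw_of_correct.
split.
  exists (INR (10 * 824)) => phi n2.
  by apply: (side_bound n2 (ltnW (lt_pow_nbits _))); apply/gside_nbits/ltnW.
split; last exact: cmw_of_weights.
(* The second graph has two items per clause, which doubles 824. *)
exists (INR (10 * 1648)) => phi m2.
apply: (@side_bound _ (nbits (nclauses phi).*2)) => //.
  by apply: leq_trans (ltnW (lt_pow_nbits _)); rewrite -addnn leq_addr.
apply: leq_trans (gside_nbits _) _; first by rewrite double_gt0 ltnW.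
by rewrite -muln2; lia.
Qed.
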